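(* Consider the stochastic time-varying problem and the prediction-correction iterates described in the context, where $\bm\alpha\in\mathbb R^n$ is the polynomial-regression coefficient vector with parameter $p$. Let $q\in[1,p]$ be an arbitrarily fixed integer. Suppose that $\bm x^\ast(t)$ is $q$-times differentiable in $t$ and $\sup_{t\ge 0}\|(\bm x^\ast)^{(q)}(t)\|<\infty$. Let $\sigma_1\ge 0$, $\mu>0$, $L_{2,0}>0$ be constants and suppose: (1) $\mathbb E_{\bm y\sim\mathcal P(t)}[\ell(\bm x;\bm y)]$ and $\mathbb E_{\bm y\sim\mathcal P(t)}[\|\nabla_{\bm x}\ell(\bm x;\bm y)\|]$ exist for all $\bm x\in\mathbb R^d$ and $t\ge 0$; (2) $\mathbb E_{\bm y\sim\mathcal P(t_k)}\big[\|\nabla_{\bm x}\ell(\bm x_k^\ast;\bm y)-\mathbb E_{\bm z\sim\mathcal P(t_k)}[\nabla_{\bm x}\ell(\bm x_k^\ast;\bm z)]\|^2\big]\le\sigma_1^2$ for all $k\ge 0$; (3) $\ell(\cdot;\bm y)$ is $\mu$-strongly convex for any $\bm y$, i.e., for all $\bm x,\bm x'\in\mathbb R^d$, $\bm y\in\mathbb R^{d_y}$: $\ell(\bm x;\bm y)\ge \ell(\bm x';\bm y)+\langle\nabla_{\bm x}\ell(\bm x';\bm y),\bm x-\bm x'\rangle+\frac{\mu}{2}\|\bm x-\bm x'\|^2$; (4) $\ell(\cdot;\bm y)$ is $L_{2,0}$-smooth for any $\bm y$, i.e., for all $\bm x,\bm x'\in\mathbb R^d$, $\bm y\in\mathbb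 R^{d_y}$: $\ell(\bm x;\bm y)\le \ell(\bm x';\bm y)+\langle\nabla_{\bm x}\ell(\bm x';\bm y),\bm x-\bm x'\rangle+\frac{L_{2,0}}{2}\|\bm x-\bm x'\|^2$; (5) $\psi$ is proper, closed and convex; (6) $\gamma\in[0,\|\bm\alpha\|_1^{-1})$ is a constant with $\|\bm x_k-\hat{\bm x}_k^\ast\|\le\gamma\|\hat{\bm x}_k-\hat{\bm x}_k^\ast\|$ for all $k\ge 0$; (7) $\Delta_1,\Delta_2\ge 0$ are constants with $\|\mathbb E[\hat{\bm x}_k^\ast]-\bm x_k^\ast\|\le\Delta_1$ and $\mathbb E[\|\hat{\bm x}_k^\ast-\bm x_k^\ast\|^2]\le\Delta_2^2$ for all $k\ge 0$. Set $n=\Theta(h^{-2q/(2q+1)})$ and let $e_k:=\mathbb E[\|\hat{\bm x}_k-\bm x_k^\ast\|]$. Then $$\limsup_{k\to\infty}e_k\le O\!\left(\Delta_1+\gamma\Delta_2+(\Delta_2+1)h^{q/(2q+1)}\right).$$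
   Context: Norms: $\|\cdot\|$ is the Euclidean norm and $\|\cdot\|_1$ the $\ell_1$-norm. $(\bm x^\ast)^{(q)}$ is the $q$-th derivative of $\bm x^\ast$. The symbols $\Theta$ and $O$ refer to a small sampling period $h$, with $p$ and $q$ fixed. Problem: for each $t\ge 0$, $\mathcal P(t)$ is a probability distribution on $\mathbb R^{d_y}$; $\ell:\mathbb R^d\times\mathbb R^{d_y}\to\mathbb R$ is a loss function, differentiable in its first argument; $\psi:\mathbb R^d\to\mathbb R\cup\{\infty\}$ is a regularization function. Set $f(\bm x;t):=\mathbb E_{\bm y\sim\mathcal P(t)}[\ell(\bm x;\bm y)]+\psi(\bm x)$ and $\bm x^\ast(t):=\mathrm{argmin}_{\bm x\in\mathbb R^d}f(\bm x;t)$ (unique by strong convexity). For a sampling period $h>0$, let $t_k:=kh$ and $\bm x_k^\ast:=\bm x^\ast(t_k)$ for $k\ge 0$. At each time $t_k$, $k=0,1,\ldots$, a sample $\bm y_k\sim\mathcal P(t_k)$ is drawn. Set $\hat\ell_k(\bm x):=\ell(\bm x;\bm y_k)$, $\hat f_k:=\hat\ell_k+\psi$, and $\hat{\bm x}_k^\ast:=\mathrm{argmin}_{\bm x\in\mathbb R^d}\hat f_k(\bm x)$ (unique by strong convexity), a random vector depending only on $\bm y_k$. Coefficients (polynomial regression): for integers $n\ge p\ge1$, let $\bm\phi(t):=(1,-t,(-t)^2,\ldots,(-t)^{p-1})^\top$, $\Phi:=(\bm\phi(-1)\ \cdots\ \bm\phi(-n))\in\mathbb R^{p\times n}$, and $\bm\alpha:=\Phi^\top(\Phi\Phi^\top)^{-1}\bm\phi(0)\in\mathbb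 R^n$. Equivalently $\alpha_i=(1,i,\ldots,i^{p-1})M^{-1}(1,0,\ldots,0)^\top$ for $i=1,\dots,n$, where $M\in\mathbb R^{p\times p}$, $M_{l,m}=\sum_{j=1}^n j^{l+m-2}$. Algorithm (Stochastic SHARP): given $\bm x_0\in\mathbb R^d$, set $\bm x_{-n+1}=\cdots=\bm x_{-1}=\bm x_0$ and $\hat{\bm x}_0:=\bm x_0$. For $k=1,2,\ldots$: (prediction) $\hat{\bm x}_k:=X_k\bm\alpha$ with $X_k:=(\bm x_{k-1}\ \cdots\ \bm x_{k-n})\in\mathbb R^{d\times n}$; (correction) $\bm x_k$ is an approximate solution of $\min_{\bm x}\hat f_k(\bm x)$ (for example, obtained by proximal gradient steps started at $\hat{\bm x}_k$). *)

(* Defs.v *)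
From HB Require Import structures.
From mathcomp Require Import all_boot all_order all_algebra finmap.
From mathcomp Require Import all_classical all_reals all_analysis.
Set Implicit Arguments.
Unset Strict Implicit.
Unset Printing Implicit Defensive.
Import Order.TTheory GRing.Theory Num.Theory.
Import numFieldNormedType.Exports.
Local Open Scope classical_set_scope.
Local Open Scope ring_scope.

(* The library norm on ['rV[R]_d] is the sup norm; it provides the topology
   (hence differentiability and the Borel sets), but every norm in the
   statement is the Euclidean norm [enorm] or the l1-norm [l1norm]. *)
Definition dotv (R : realType) (d : nat) (u v : 'rV[R]_d) : R :=
  \sum_(i < d) u 0 i * v 0 i.

Definition enorm (R : realType) (d : nat) (v : 'rV[R]_d) : R :=
  Num.sqrt (dotv v v).

Definition l1norm (R : realType) (n : nat) (a : 'cV[R]_n) : R :=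
  \sum_(i < n) `|a i 0|.

(* R^d with its Borel sigma-algebra; convertible to ['rV[R]_d]. *)
Notation borel R d := (g_sigma_algebraType (@open 'rV[R]_d)).

(* The transposed Jacobian: for f differentiable at x this is the vector with
   <grad f x, v> = 'd f x v. *)
Definition grad (R : realType) (d : nat) (f : 'rV[R]_d -> R) (x : 'rV[R]_d)
    : 'rV[R]_d :=
  \row_(i < d) ('d f x (delta_mx 0 i) : R).

(* [fine] sends the value of a non-integrable coordinate to a junk value. *)
Definition vexpectation (R : realType) (d : nat) (disp : measure_display)
    (T : measurableType disp) (P : probability T R) (X : T -> 'rV[R]_d)
    : 'rV[R]_d :=
  \row_(i < d) fine ('E_P[fun w => X w 0 i]).

Definition is_argmin (R : realType) (T : Type) (f : T -> \bar R) (x : T) : Prop :=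
  forall z, (f x <= f z)%E.

Definition mutually_independent (R : realType) (disp disp' : measure_display)
    (T : measurableType disp) (T' : measurableType disp')
    (P : probability T R) (X : nat -> T -> T') : Prop :=
  forall (J : {fset nat}) (A : nat -> set T'),
    (forall j, j \in J -> measurable (A j)) ->
    P (\bigcap_(j in [set` J]) (X j @^-1` A j)) =
    (\prod_(j <- J) fine (P (X j @^-1` A j)))%:E.

Section ExtendedRealFunctions.
Context (R : realType) (d : nat).
Implicit Types psi : 'rV[R]_d -> \bar R.

Definition proper_fun psi : Prop :=
  (forall x, psi x != -oo%E) /\ (exists x, psi x != +oo%E).

Definition closed_fun psi : Prop :=
  closed [set xr : 'rV[R]_d * R | (psi xr.1 <= xr.2%:E)%E].

Definition convex_fun psi : Prop :=
  forall (x y : 'rV[R]_d) (s : R), 0 < s < 1 ->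
    (psi (s *: x + (1 - s) *: y)%R <= s%:E * psi x + (1 - s)%R%:E * psi y)%E.

End ExtendedRealFunctions.

(* Derivatives of a function of t >= 0: two-sided at t > 0 and one-sided at
   t = 0; no value of f on the negative half-line is involved. *)
Section HalfLineDerivative.
Context (R : realType) (V : normedModType R).
Implicit Types f : R -> V.

Definition hl_quotient f (t s : R) : V := s^-1 *: (f (t + s) - f t).

Definition hl_derivable f (t : R) : Prop :=
  cvg (hl_quotient f t @ within [set s | 0 <= t + s] 0^').

Definition hl_derive f (t : R) : V :=
  lim (hl_quotient f t @ within [set s | 0 <= t + s] 0^').

Definition hl_deriven (j : nat) f : R -> V := iter j hl_derive f.

Definition hl_n_derivable (q : nat) f : Prop :=
  forall j, (j < q)%N -> forall t, 0 <= t -> hl_derivable (hl_deriven j f) t.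

End HalfLineDerivative.

Section PolynomialRegression.
Context (R : realType) (p n : nat).

Definition prvec (t : R) : 'cV[R]_p := \col_(i < p) (- t) ^+ i.

Definition prmx : 'M[R]_(p, n) := \matrix_(i < p, j < n) prvec (- j.+1%:R) i 0.

Definition pralpha : 'cV[R]_n :=
  prmx^T *m invmx (prmx *m prmx^T) *m prvec 0.

End PolynomialRegression.

(* hat x_k computed from x_0, ..., x_{k-1}: the coefficient with index i (from
   0) multiplies x_{k-i-1}.  Truncated subtraction turns every negative index
   into 0, which is the padding x_{-n+1} = ... = x_{-1} = x_0. *)
Definition predict (R : realType) (d n : nat) (a : 'cV[R]_n)
    (x : nat -> 'rV[R]_d) (k : nat) : 'rV[R]_d :=
  if k == 0%N then x 0%N else \sum_(i < n) a i 0 *: x (k - i.+1)%N.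

Definition objective (R : realType) (d dy : nat)
    (P : R -> probability (borel R dy) R)
    (l : 'rV[R]_d -> 'rV[R]_dy -> R) (psi : 'rV[R]_d -> \bar R)
    (t : R) (x : 'rV[R]_d) : \bar R :=
  ('E_(P t)[fun y => l x y] + psi x)%E.

Definition sample_objective (R : realType) (d dy : nat)
    (l : 'rV[R]_d -> 'rV[R]_dy -> R) (psi : 'rV[R]_d -> \bar R)
    (y : 'rV[R]_dy) (x : 'rV[R]_d) : \bar R :=
  ((l x y)%:E + psi x)%E.

(* Main.v *)
Require Import Defs.
From HB Require Import structures.
From mathcomp Require Import all_boot all_order all_algebra finmap.
From mathcomp Require Import all_classical all_reals all_analysis measurable_realfun.
From mathcomp Require Import ring lra zify.
Set Implicit Arguments.
Unset Strict Implicit.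
Unset Printing Implicit Defensive.
Import Order.TTheory GRing.Theory Num.Theory.
Import numFieldNormedType.Exports.
Local Open Scope classical_set_scope.
Local Open Scope ring_scope.

(* The error e_k = hat x_k - x*_k obeys e_k = g_k + sum_i alpha_i r_{k-i}, where
   r_j = x_j - hat x*_j satisfies |r_j| <= gamma (|e_j| + |hat x*_j - x*_j|) and g_k is the
   extrapolation error of x* (Taylor: O((n h)^q)) plus an average of independent samples
   (O(Delta1 + |alpha|_2 Delta2) in mean, with |alpha|_2 = O(n^(-1/2))).  Taking norms would
   only give the factor 1/(1 - gamma |alpha|_1), which need not stay bounded as h -> 0,
   because |alpha|_1 depends on n and gamma |alpha|_1 may tend to 1.  The recursion is
   nevertheless uniformly contracting, since gamma < 1 is fixed and sum_i alpha_i = 1: if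
   the inputs r kept an output at its maximal norm, they would all have to be aligned with
   it wherever alpha_i >= 1/(2n), i.e. on the most recent c n indices; hence consecutive
   outputs would be aligned too and e would be nearly constant on a window of T n steps,
   while the average of e over that window is at most gamma + O(1/T) times its maximum.
   Writing r_j as a linear image of e_j plus a remainder, e is pathwise a superposition of
   responses to single sources; each is of order 1/n after its impulse and decays
   geometrically in blocks of n steps, so that one may take expectations term by term. *)

(** Bounding the error by the largest source so far would not survive the expectation: the mean of a
    maximum over all past times is not controlled by the individual second moments. This is why the
    responses are summed against a deterministic kernel, whose sums over the non-initial sources are
    bounded independently of n. Independence is used only inside g_k, which averages minimizers of
    single samples; the iterates depend on the whole past and enter only through norm inequalities.
    All constants are fixed before h and the problem data, so every smallness argument must be
    uniform in n. The estimates on alpha avoid asymptotics of the inverse Gram matrix: alpha_i is a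
    polynomial in i of degree below p, its coefficients are recovered from equally spaced values,
    and its l1 norm is bounded by a self-improving inequality. The order of n makes n^(-1/2) and (n
    h)^q both of order h^(q/(2q+1)). *)

(** * Euclidean norm and inner product *)

Section EuclideanNorm.
Context (R : realType) (d : nat).
Implicit Types (u v w : 'rV[R]_d) (a b : R).

Lemma dotvC u v : dotv u v = dotv v u.
Proof. by apply: eq_bigr => i _; rewrite mulrC. Qed.

Lemma dotvDl u v w : dotv (u + v) w = dotv u w + dotv v w.
Proof. by rewrite -big_split; apply: eq_bigr => i _; rewrite mxE mulrDl. Qed.

Lemma dotvDr u v w : dotv w (u + v) = dotv w u + dotv w v.
Proof. by rewrite !(dotvC w) dotvDl. Qed.

Lemma dotvZl a u w : dotv (a *: u) w = a * dotv u w.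
Proof. by rewrite /dotv big_distrr/=; apply: eq_bigr => i _; rewrite mxE mulrA. Qed.

Lemma dotvZr a u w : dotv w (a *: u) = a * dotv w u.
Proof. by rewrite !(dotvC w) dotvZl. Qed.

Lemma dotv_sumr (I : Type) (r : seq I) (P : pred I) (F : I -> 'rV[R]_d) w :
  dotv w (\sum_(i <- r | P i) F i) = \sum_(i <- r | P i) dotv w (F i).
Proof.
elim/big_rec2 : _ => [|i x y _ <-]; last by rewrite dotvDr.
by rewrite /dotv big1// => i _; rewrite mxE mulr0.
Qed.

Lemma dotv_ge0 u : 0 <= dotv u u.
Proof. by apply: sumr_ge0 => i _; rewrite -expr2 sqr_ge0. Qed.

Lemma enorm_ge0 u : 0 <= enorm u.
Proof. exact: sqrtr_ge0. Qed.
Hint Resolve enorm_ge0 : core.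

Lemma enorm_sqr u : enorm u ^+ 2 = dotv u u.
Proof. by rewrite sqr_sqrtr// dotv_ge0. Qed.

Lemma enorm_sqrE u : enorm u ^+ 2 = \sum_(i < d) u 0 i ^+ 2.
Proof. by rewrite enorm_sqr; apply: eq_bigr => i _; rewrite expr2. Qed.

Lemma ler_coord_enorm u i : `|u 0 i| <= enorm u.
Proof.
rewrite -sqrtr_sqr ler_wsqrtr// /dotv (bigD1 i)//= -expr2 lerDl sumr_ge0// => j _.
by rewrite -expr2 sqr_ge0.
Qed.

Lemma enorm_le_sum u : enorm u <= \sum_(i < d) `|u 0 i|.
Proof.
rewrite -[leRHS]ger0_norm ?sumr_ge0// -sqrtr_sqr ler_wsqrtr//.
rewrite expr2 big_distrl/= ler_sum// => i _.
rewrite (le_trans (ler_norm _))// normrM ler_wpM2l//.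
by rewrite (bigD1 i)//= lerDl sumr_ge0.
Qed.

Lemma enorm_eq0 u : (enorm u == 0) = (u == 0).
Proof.
apply/idP/eqP => [/eqP u0|->]; last first.
  by rewrite /enorm /dotv big1 ?sqrtr0// => i _; rewrite mxE mulr0.
apply/matrixP => i j; rewrite ord1 mxE; apply/eqP.
by rewrite -normr_le0 -u0 ler_coord_enorm.
Qed.

Lemma enorm0 : enorm (0 : 'rV[R]_d) = 0.
Proof. by apply/eqP; rewrite enorm_eq0. Qed.

Lemma enormZ a u : enorm (a *: u) = `|a| * enorm u.
Proof. by rewrite /enorm dotvZl dotvZr mulrA -expr2 sqrtrM ?sqr_ge0// sqrtr_sqr. Qed.

Lemma enormN u : enorm (- u) = enorm u.
Proof. by rewrite -scaleN1r enormZ normrN1 mul1r. Qed.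

Lemma dotv_le u v : dotv u v <= enorm u * enorm v.
Proof.
have [/eqP|u0] := eqVneq (enorm u) 0.
  rewrite enorm_eq0 => /eqP ->; rewrite enorm0 mul0r.
  by rewrite /dotv big1// => i _; rewrite mxE mul0r.
have [/eqP|v0] := eqVneq (enorm v) 0.
  rewrite enorm_eq0 => /eqP ->; rewrite enorm0 mulr0.
  by rewrite /dotv big1// => i _; rewrite mxE mulr0.
have u1 : 0 < enorm u by rewrite lt_neqAle eq_sym u0 enorm_ge0.
have v1 : 0 < enorm v by rewrite lt_neqAle eq_sym v0 enorm_ge0.
have := dotv_ge0 (enorm v *: u + (- enorm u) *: v).
rewrite !(dotvDl, dotvDr, dotvZl, dotvZr) (dotvC v u) -!enorm_sqr.
set x := enorm u; set y := enorm v; set z := dotv u v => H.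
suff : 0 <= (2 * (x * y)) * (x * y - z) by rewrite pmulr_rge0 ?mulr_gt0// subr_ge0.
by move: H; lra.
Qed.

Lemma ler_dotv_norm u v : `|dotv u v| <= enorm u * enorm v.
Proof.
rewrite ler_norml dotv_le andbT lerNl.
by have := dotv_le (-1 *: u) v; rewrite dotvZl enormZ normrN1 mul1r mulN1r.
Qed.

Lemma enormD u v : enorm (u + v) <= enorm u + enorm v.
Proof.
rewrite -(@ler_pXn2r _ 2)// ?nnegrE ?addr_ge0//.
rewrite enorm_sqr !(dotvDl, dotvDr) (dotvC v u) -!enorm_sqr.
have := dotv_le u v; lra.
Qed.

Lemma enormB u v : enorm (u - v) <= enorm u + enorm v.
Proof. by rewrite -[enorm v]enormN enormD. Qed.

Lemma enorm_sum (I : Type) (r : seq I) (P : pred I) (F : I -> 'rV[R]_d) :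
  enorm (\sum_(i <- r | P i) F i) <= \sum_(i <- r | P i) enorm (F i).
Proof.
elim/big_rec2 : _ => [|i x y _ h]; first by rewrite enorm0.
by rewrite (le_trans (enormD _ _))// lerD2l.
Qed.

Lemma enorm_lin_sum (n : nat) (c : 'I_n -> R) (F : 'I_n -> 'rV[R]_d) :
  enorm (\sum_(i < n) c i *: F i) <= \sum_(i < n) `|c i| * enorm (F i).
Proof.
by rewrite (le_trans (enorm_sum _ _ _))// ler_sum// => i _; rewrite enormZ.
Qed.

Lemma enorm_parallelogram u v :
  enorm (u - v) ^+ 2 = 2 * enorm u ^+ 2 + 2 * enorm v ^+ 2 - enorm (u + v) ^+ 2.
Proof.
rewrite !enorm_sqr -scaleN1r !(dotvDl, dotvDr, dotvZl, dotvZr) (dotvC v u); ring.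
Qed.

End EuclideanNorm.
#[global] Hint Extern 0 (is_true (0 <= enorm _)) => solve [apply: enorm_ge0] : core.

Lemma sqr_sum_le (R : realType) n (f : 'I_n -> R) :
  (\sum_(i < n) f i) ^+ 2 <= n%:R * \sum_(i < n) f i ^+ 2.
Proof.
have := ler_dotv_norm (\row_(i < n) f i) (const_mx 1).
rewrite -(@ler_pXn2r _ 2)// ?nnegrE ?mulr_ge0 ?enorm_ge0// exprMn !enorm_sqrE.
rewrite real_normK ?num_real//.
rewrite /dotv [X in _ <= _ * X](eq_bigr (fun=> 1)) => [|i _]; last by rewrite mxE expr1n.
rewrite sumr_const card_ord mulrC; congr (_ ^+ 2 <= _ * _).
  by apply: eq_bigr => i _; rewrite !mxE mulr1.
by apply: eq_bigr => i _; rewrite mxE.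
Qed.

(** * Polynomial-regression weights: moments and coefficients *)

Section PolynomialRegressionWeights.
Context (R : realType).
Implicit Types (p n : nat).

Lemma prmxE p n i j : prmx R p n i j = j.+1%:R ^+ i.
Proof. by rewrite /prmx !mxE opprK. Qed.

Lemma vandermonde_nodes_unit p :
  (\matrix_(i < p, j < p) (j.+1%:R : R) ^+ i) \in unitmx.
Proof.
have -> : (\matrix_(i < p, j < p) (j.+1%:R : R) ^+ i)
    = Vandermonde p (\row_j j.+1%:R).
  by apply/matrixP => i j; rewrite !mxE.
rewrite unitmxE det_Vandermonde unitfE; apply/prodf_neq0 => i _.
apply/prodf_neq0 => j ij.
rewrite !mxE subr_eq0 eqr_nat eqSS neq_ltn; apply/orP; right; exact: ij.
Qed.

(** A left kernel vector of the Gram matrix gives a polynomial of degree below [p] that vanishes at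
    1, ..., n; its first [p] values already force it to be zero, by the Vandermonde determinant. *)
Lemma gram_unit p n : (p <= n)%N -> prmx R p n *m (prmx R p n)^T \in unitmx.
Proof.
move=> pn; rewrite -row_free_unit; apply: inj_row_free => v vG0.
have v0 : v *m prmx R p n = 0.
  have : (v *m prmx R p n) *m (v *m prmx R p n)^T = 0.
    by rewrite trmx_mul mulmxA -(mulmxA v) vG0 mul0mx.
  move/matrixP => /(_ 0 0); rewrite !mxE => /eqP.
  rewrite psumr_eq0; last by move=> i _; rewrite [X in _ * X]mxE -expr2 sqr_ge0.
  move=> /allP s0; apply/matrixP => i j; rewrite ord1.
  have := s0 j (mem_index_enum _).
  by rewrite [X in _ * X]mxE /= mulf_eq0 orbb [RHS]mxE => /eqP.
have := vandermonde_nodes_unit p; rewrite -row_free_unit => /row_free_inj Vinj.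
apply: (Vinj _ _ _); rewrite mul0mx; apply/matrixP => i j.
move/matrixP: v0 => /(_ i (widen_ord pn j)); rewrite [LHS]mxE [RHS]mxE => v0.
rewrite [RHS]mxE -v0 mxE; apply: eq_bigr => l _.
by rewrite prmxE mxE.
Qed.

(** By [pralphaE] these are the coefficients of a polynomial whose value at i+1 is the weight with
    index i; the regularity of the weights is read off from them. *)
Definition prcoef p n : 'cV[R]_p :=
  invmx (prmx R p n *m (prmx R p n)^T) *m prvec p (0 : R).

Lemma pralphaE p n i :
  pralpha R p n i 0 = \sum_(l < p) prcoef p n l 0 * i.+1%:R ^+ l.
Proof.
rewrite /pralpha -mulmxA mxE; apply: eq_bigr => l _.
by rewrite mxE prmxE mulrC.
Qed.

Lemma pralpha_moment p n j : (p <= n)%N -> (j < p)%N ->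
  \sum_(i < n) pralpha R p n i 0 * i.+1%:R ^+ j = (j == 0)%:R.
Proof.
move=> pn jp.
have : prmx R p n *m pralpha R p n = prvec p (0 : R).
  by rewrite /pralpha !mulmxA mulmxV ?gram_unit// mul1mx.
move/matrixP => /(_ (Ordinal jp) 0); rewrite !mxE oppr0 expr0n /= => <-.
by apply: eq_bigr => i _; rewrite prmxE mulrC.
Qed.

Lemma pralpha_sum p n : (0 < p <= n)%N -> \sum_(i < n) pralpha R p n i 0 = 1.
Proof.
move=> /andP[p0 pn]; rewrite -[RHS](pralpha_moment pn p0).
by apply: eq_bigr => i _; rewrite expr0 mulr1.
Qed.

(** One factor of each square is expanded as a polynomial; the moment conditions annihilate every
    degree but zero. *)
Lemma pralpha_sqr p n (p0 : (0 < p)%N) : (p <= n)%N ->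
  \sum_(i < n) pralpha R p n i 0 ^+ 2 = prcoef p n (Ordinal p0) 0.
Proof.
move=> pn; under eq_bigr do rewrite expr2 {2}pralphaE big_distrr/=.
rewrite exchange_big/= (bigD1 (Ordinal p0))//= [X in _ + X]big1 ?addr0.
  under eq_bigr => i _ do rewrite expr0 mulr1.
  by rewrite -big_distrl/= pralpha_sum ?p0// mul1r.
move=> l l0; transitivity (prcoef p n l 0 * \sum_(i < n) pralpha R p n i 0 * i.+1%:R ^+ l).
  by rewrite big_distrr/=; apply: eq_bigr => i _; rewrite mulrCA.
rewrite pralpha_moment//; case: eqP => [l0'|]; last by rewrite mulr0.
by move/eqP: l0; case; apply: val_inj.
Qed.

Lemma exprn_le_sum_expr N l :
  (N%:R : R) ^+ l.+1 <= l.+1%:R * \sum_(1 <= m < N.+1) m%:R ^+ l.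
Proof.
elim: N => [|N IH]; first by rewrite exprS mul0r big_nil mulr0.
rewrite big_nat_recr//= mulrDr.
have : (N.+1%:R : R) ^+ l.+1 - N%:R ^+ l.+1 <= l.+1%:R * N.+1%:R ^+ l.
  rewrite subrXX -natr1 addrAC subrr add0r mul1r natr1.
  rewrite [X in _ <= X]mulr_natl -[X in _ <= _ *+ X]card_ord -sumr_const ler_sum//.
  move=> i _; have il : (i <= l)%N by rewrite -ltnS.
  have -> : N.+1%:R ^+ l = N.+1%:R ^+ (l - i) * N.+1%:R ^+ i :> R.
    by rewrite -exprD subnK.
  rewrite ler_wpM2l ?exprn_ge0// lerXn2r ?nnegrE// ler_nat//.
by lra.
Qed.

Definition nodeinv p : 'M[R]_p :=
  invmx (\matrix_(i < p, j < p) (j.+1%:R : R) ^+ i).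

(* The coefficient of degree [l] is read off the values at [m, 2m, ..., pm]. *)
Lemma prcoef_nodes p n m (l : 'I_p) : (p * m <= n)%N -> (0 < m)%N ->
  exists2 f : 'I_p -> 'I_n, forall t, ((f t).+1 = t.+1 * m)%N &
  prcoef p n l 0 * m%:R ^+ l = \sum_(t < p) pralpha R p n (f t) 0 * nodeinv p t l.
Proof.
move=> pmn m0.
have ft (t : 'I_p) : ((t.+1 * m).-1 < n)%N.
  rewrite prednK ?muln_gt0//; apply: leq_trans pmn; by rewrite leq_mul2r ltn_ord orbT.
exists (fun t => Ordinal (ft t)).
  by move=> t; rewrite /= prednK// muln_gt0.
have V : forall k : 'I_p, \sum_(t < p) t.+1%:R ^+ k * nodeinv p t l = (k == l)%:R.
  move=> k; have /matrixP/(_ k l) := mulmxV (vandermonde_nodes_unit p).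
  by rewrite !mxE => <-; apply: eq_bigr => t _; rewrite mxE.
transitivity (\sum_(t < p) \sum_(k < p)
    prcoef p n k 0 * m%:R ^+ k * (t.+1%:R ^+ k * nodeinv p t l)); last first.
  apply: eq_bigr => t _; rewrite pralphaE /= prednK ?muln_gt0// big_distrl/=.
  by apply: eq_bigr => k _; rewrite natrM exprMn; ring.
rewrite exchange_big/= (bigD1 l)//= [X in _ + X]big1 => [|k kl].
  by rewrite -big_distrr/= V eqxx mulr1 addr0.
by rewrite -big_distrr/= V (negPf kl) mulr0.
Qed.

(** [prcoef_nodes] is summed over all spacings m up to N = n/p. The powers of m add up to order
    N^(l+1), while the right-hand sides together stay below a multiple of the l1 norm. *)
Lemma prcoef_nodes_le p : exists2 C : R, 0 < C & forall n, (0 < p <= n)%N -> forall l : 'I_p,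
  `|prcoef p n l 0| * (n %/ p)%N%:R ^+ l.+1 <= C * \sum_(i < n) `|pralpha R p n i 0|.
Proof.
pose D : R := 1 + \sum_(t < p) \sum_(l < p) `|nodeinv p t l|.
have D1 : 1 <= D by rewrite lerDl sumr_ge0// => t _; rewrite sumr_ge0.
have DC (t l : 'I_p) : `|nodeinv p t l| <= D.
  rewrite /D (bigD1 t)//= (bigD1 l)//= addrCA !addrA -!addrA lerDl.
  rewrite addr_ge0 ?addr_ge0 ?sumr_ge0// => i _; exact: sumr_ge0.
exists (p.+1%:R * (D * p.+1%:R)); first by rewrite !mulr_gt0 ?ltr0n// (lt_le_trans _ D1).
move=> n /andP[p0 pn] l; set N := (n %/ p)%N; set S := \sum_(i < n) _.
have S0 : 0 <= S by exact: sumr_ge0.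
have H1 m : (1 <= m < N.+1)%N -> `|prcoef p n l 0| * m%:R ^+ l
    <= D * \sum_(t < p) \sum_(i < n | (i.+1 == t.+1 * m)%N) `|pralpha R p n i 0|.
  move=> /andP[m0 mN]; have pmn : (p * m <= n)%N.
    by rewrite mulnC; apply: leq_trans (leq_divM n p); rewrite leq_mul2r -ltnS mN orbT.
  have [f fE cE] := prcoef_nodes l pmn m0.
  rewrite -[m%:R ^+ l]ger0_norm ?exprn_ge0// -normrM cE.
  rewrite (le_trans (ler_norm_sum _ _ _))// big_distrr/= ler_sum// => t _.
  rewrite normrM mulrC ler_pM// (bigD1 (f t)) ?fE//= lerDl; exact: sumr_ge0.
rewrite -/N -mulrA; apply: (@le_trans _ _ (l.+1%:R * (D * (p%:R * S)))); last first.
  by rewrite -!mulrA !(ler_pM, ler_nat, mulr_ge0)// ?ltnS ?(ltnW (ltn_ord _))//; lra.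
apply: (@le_trans _ _ (`|prcoef p n l 0| * (l.+1%:R * \sum_(1 <= m < N.+1) m%:R ^+ l))).
  by rewrite ler_wpM2l// exprn_le_sum_expr.
rewrite mulrCA ler_wpM2l// big_distrr/=.
apply: (@le_trans _ _ (\sum_(1 <= m < N.+1)
   D * \sum_(t < p) \sum_(i < n | (i.+1 == t.+1 * m)%N) `|pralpha R p n i 0|)).
  by rewrite !big_nat ler_sum// => m mN; exact: H1.
rewrite -big_distrr/= ler_wpM2l//; first by lra.
rewrite exchange_big/= mulr_natl -[X in _ *+ X]card_ord -sumr_const ler_sum// => t _.
rewrite /S (exchange_big_dep xpredT)//= ler_sum// => i _.
rewrite big_mkcond/=.
(* For a fixed node t, an index i is sampled by at most one spacing m, so no weight is counted
   twice. *)
set m0 := (i.+1 %/ t.+1)%N.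
have mE m : (i.+1 == t.+1 * m)%N -> m = m0.
  by move=> /eqP E; rewrite /m0 E mulKn.
have [min|mout] := boolP (m0 \in index_iota 1 N.+1).
  rewrite (bigD1_seq m0) ?iota_uniq//= [X in _ + X]big1 ?addr0; first by case: ifP.
  by move=> m mm0; case: ifP => // /mE E; rewrite E eqxx in mm0.
rewrite big1_seq// => m /= mr; case: ifP => // /mE E.
by rewrite E (negPf mout) in mr.
Qed.

End PolynomialRegressionWeights.

(** * Size and smoothness of the weights, uniformly in n *)

Section RegularWeights.
Context (R : realType).
Implicit Types (p n : nat).

(* Asymptotically [a i = K(i/n)/n] for a Lipschitz kernel [K] with [K 0 > 0]. *)
Record regular_weights (C : R) n (a : nat -> R) : Prop := RegularWeights {
  rw_sum : \sum_(i < n) a i = 1;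
  rw_norm1 : \sum_(i < n) `|a i| <= C;
  rw_bound : forall i, (i < n)%N -> `|a i| <= C / n%:R;
  rw_lip : forall i, (i.+1 < n)%N -> `|a i.+1 - a i| <= C / n%:R ^+ 2;
  rw_lower : forall i, (i < n)%N -> 2 * C * i.+1%:R <= n%:R -> (2 * n%:R)^-1 <= a i }.

Definition prweight p n (i : nat) : R := \sum_(l < p) prcoef R p n l 0 * i.+1%:R ^+ l.

Lemma prweightE p n (i : 'I_n) : prweight p n i = pralpha R p n i 0.
Proof. by rewrite pralphaE. Qed.

(** The l1 norm S bounds itself: by Cauchy-Schwarz, S^2 is at most n times the sum of squares; that
    sum is the constant coefficient, which [prcoef_nodes_le] bounds by a multiple of S/n. *)
Lemma pralpha_norm1_le p : exists2 C : R, 0 < C &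
  forall n, (0 < p <= n)%N -> \sum_(i < n) `|pralpha R p n i 0| <= C.
Proof.
have [C C0 H] := prcoef_nodes_le R p.
exists (C * (2 * p%:R) + 1); first by rewrite ltr_wpDl// mulr_ge0// ltW.
move=> n /andP[p0 pn]; have := H n _ (Ordinal p0); rewrite p0 pn => /(_ isT).
set N := (n %/ p)%N; set S := \sum_(i < n) _ => H0.
have N0 : (0 < N)%N by rewrite divn_gt0.
have nN : (n%:R : R) <= 2 * p%:R * N%:R.
  rewrite -!natrM ler_nat; have := ltn_ceil n p0; rewrite -/N; nia.
have S0 : 0 <= S by exact: sumr_ge0.
have SN : S ^+ 2 <= n%:R * prcoef R p n (Ordinal p0) 0.
  rewrite -pralpha_sqr// (le_trans (sqr_sum_le _))//.
  by rewrite ler_wpM2l// ler_sum// => i _; rewrite real_normK ?num_real.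
have b0 : 0 <= prcoef R p n (Ordinal p0) 0.
  by rewrite -pralpha_sqr// sumr_ge0// => i _; rewrite sqr_ge0.
rewrite expr1 ger0_norm// in H0.
have : S * S <= (C * (2 * p%:R)) * S.
  rewrite -expr2 (le_trans SN)//.
  apply: (@le_trans _ _ (2 * p%:R * N%:R * prcoef R p n (Ordinal p0) 0)).
    by rewrite ler_wpM2r.
  have p2 : 0 <= 2 * p%:R :> R by [].
  have := ler_wpM2l p2 H0; lra.
have [->|Sn0] := eqVneq S 0; first by move=> _; rewrite addr_ge0// mulr_ge0// ltW.
rewrite ler_pM2r ?lt_neqAle 1?eq_sym ?Sn0//; lra.
Qed.

Lemma prcoef_le p : exists2 C : R, 0 < C &
  forall n, (0 < p <= n)%N -> forall l : 'I_p, `|prcoef R p n l 0| <= C / n%:R ^+ l.+1.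
Proof.
have [C C0 H] := prcoef_nodes_le R p.
have [S S0 HS] := pralpha_norm1_le p.
exists (C * S * (2 * p%:R + 1) ^+ p).
  by rewrite !mulr_gt0// exprn_gt0// ltr_wpDl.
move=> n np l; have /andP[p0 pn] := np.
have N0 : (0 < n %/ p)%N by rewrite divn_gt0.
have nN : (n%:R : R) <= 2 * p%:R * (n %/ p)%N%:R.
  rewrite -!natrM ler_nat; have := ltn_ceil n p0; nia.
have n0 : 0 < n%:R :> R by rewrite ltr0n (leq_trans p0).
rewrite ler_pdivlMr ?exprn_gt0//.
apply: (@le_trans _ _ (`|prcoef R p n l 0| * ((2 * p%:R) * (n %/ p)%N%:R) ^+ l.+1)).
  by rewrite ler_wpM2l// lerXn2r// ?nnegrE// ?mulr_ge0.
rewrite exprMn mulrCA.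
apply: (@le_trans _ _ ((2 * p%:R) ^+ l.+1 * (C * S))).
  rewrite ler_wpM2l ?exprn_ge0// (le_trans (H n np l))// ler_wpM2l ?HS//; exact: ltW.
rewrite mulrC ler_wpM2l ?(mulr_ge0 (ltW C0) (ltW S0))//.
have p1 : (1 : R) <= 2 * p%:R + 1 by rewrite lerDr mulr_ge0.
apply: (@le_trans _ _ ((2 * p%:R + 1) ^+ l.+1)).
  by rewrite lerXn2r// ?nnegrE ?addr_ge0 ?mulr_ge0// lerDl.
by rewrite ler_weXn2l.
Qed.

(** Mean value estimate for x^l, multiplied by n so that the exponent l - 1 does not appear. *)
Lemma exprSn_sub_le (x n : R) l : 0 <= x -> x + 1 <= n ->
  ((x + 1) ^+ l - x ^+ l) * n <= l%:R * n ^+ l.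
Proof.
move=> x0 xn; elim: l => [|l IH]; first by rewrite subrr !mul0r.
have n0 : 0 <= n by lra.
have h : 0 <= (x + 1) ^+ l - x ^+ l by rewrite subr_ge0 lerXn2r ?nnegrE//; lra.
have xl : x ^+ l <= n ^+ l by rewrite lerXn2r ?nnegrE//; lra.
have -> : ((x + 1) ^+ l.+1 - x ^+ l.+1) * n
   = (x + 1) * (((x + 1) ^+ l - x ^+ l) * n) + x ^+ l * n by rewrite !exprS; ring.
have -> : l.+1%:R * n ^+ l.+1 = n * (l%:R * n ^+ l) + n ^+ l * n.
  by rewrite -natr1 exprS; ring.
rewrite lerD ?ler_wpM2r//.
apply: le_trans (ler_wpM2l n0 IH).
by rewrite ler_wpM2r// mulr_ge0.
Qed.

Lemma pralpha_regular p : (0 < p)%N -> exists2 C : R, 1 <= C &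
  forall n, (p <= n)%N -> regular_weights C n (prweight p n).
Proof.
move=> p0.
have [S S0 HS] := pralpha_norm1_le p.
have [C C0 HC] := prcoef_le p.
have p1 : 1 <= p%:R :> R by rewrite ler1n.
(* S serves [rw_norm1]; p^2 C serves [rw_lip] and dominates the p C used for [rw_bound] and
   [rw_lower]; the final 1 makes the constant at least 1. *)
exists (S + p%:R ^+ 2 * C + 1); first by rewrite lerDr addr_ge0 ?mulr_ge0// ltW.
move=> n pn.
have n0 : 0 < n%:R :> R by rewrite ltr0n (leq_trans p0).
have np : (0 < p <= n)%N by rewrite p0.
have Cp : p%:R * C <= S + p%:R ^+ 2 * C + 1.
  have := @ler_wpM2r _ (p%:R * C) _ 1 p%:R p1; rewrite mulr_ge0 ?(ltW C0)// => /(_ isT).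
  lra.
have term (l : 'I_p) x : 0 <= x -> x <= n%:R ->
    `|prcoef R p n l 0| * x ^+ l <= C / n%:R.
  move=> x0 xn; apply: (@le_trans _ _ (C / n%:R ^+ l.+1 * n%:R ^+ l)).
    by rewrite ler_pM ?HC ?exprn_ge0// lerXn2r// nnegrE// ltW.
  by rewrite exprS invfM -!mulrA mulVf ?mulr1// expf_neq0// gt_eqF.
split.
- rewrite -(pralpha_sum R np); apply: eq_bigr => i _; exact: prweightE.
- under eq_bigr do rewrite prweightE.
  have := HS n np; have : 0 <= p%:R ^+ 2 * C by rewrite mulr_ge0// ltW.
  lra.
- move=> i ni; rewrite /prweight (le_trans (ler_norm_sum _ _ _))//.
  apply: (@le_trans _ _ (\sum_(l < p) C / n%:R)).
    apply: ler_sum => l _; rewrite normrM normrX normr_nat; apply: term => //.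
    by rewrite ler_nat.
  rewrite sumr_const card_ord -[_ *+ p]mulr_natl mulrA ler_wpM2r ?invr_ge0//; exact: ltW.
- move=> i ni; rewrite /prweight -sumrB (le_trans (ler_norm_sum _ _ _))//.
  apply: (@le_trans _ _ (\sum_(l < p) p%:R * C / n%:R ^+ 2)).
    apply: ler_sum => l _; rewrite -mulrBr normrM -[i.+2%:R]natr1.
    rewrite [X in _ * X]ger0_norm; last first.
      by rewrite subr_ge0 lerXn2r ?nnegrE// lerDl.
    rewrite ler_pdivlMr ?exprn_gt0// expr2 mulrA -[in X in X * _]mulrA.
    apply: (@le_trans _ _ (C / n%:R ^+ l.+1 * (p%:R * n%:R ^+ l) * n%:R)).
      rewrite ler_wpM2r ?(ltW n0)//; apply: ler_pM; rewrite ?HC//.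
        rewrite mulr_ge0 ?(ltW n0)// subr_ge0 lerXn2r ?nnegrE// lerDl//.
      apply: le_trans (exprSn_sub_le _ _ _) _ => //; first by rewrite natr1 ler_nat.
      by rewrite ler_wpM2r ?exprn_ge0 ?(ltW n0)// ler_nat ltnW.
    rewrite le_eqVlt; apply/orP; left; apply/eqP.
    rewrite exprS; field; rewrite ?gt_eqF ?exprn_gt0//.
  rewrite sumr_const card_ord -[_ *+ p]mulr_natl mulrA ler_wpM2r ?invr_ge0 ?exprn_ge0 ?(ltW n0)//.
  by rewrite mulrA -expr2; lra.
- move=> i ni; rewrite -mulrA => Hi.
  have Cn : 0 < p%:R * C * i.+1%:R by rewrite !mulr_gt0 ?ltr0n.
  (* The constant coefficient is the sum of squares, hence at least 1/n because the weights sum to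
     1; for small i the other terms take away at most half of 1/n. *)
  have a0 : n%:R^-1 <= prcoef R p n (Ordinal p0) 0.
    rewrite -pralpha_sqr//; have := sqr_sum_le (fun i : 'I_n => pralpha R p n i 0).
    by rewrite pralpha_sum// expr1n -ler_pdivrMl// mulr1.
  have -> : prweight p n i = prcoef R p n (Ordinal p0) 0
      + \sum_(l < p | l != Ordinal p0) prcoef R p n l 0 * i.+1%:R ^+ l.
    by rewrite /prweight (bigD1 (Ordinal p0))//= mulr1.
  set T := \sum_(l < p | _) _.
  have HT : `|T| <= p%:R * C * i.+1%:R / n%:R ^+ 2.
    rewrite /T (le_trans (ler_norm_sum _ _ _))//.
    apply: (@le_trans _ _ (\sum_(l < p | l != Ordinal p0) C * i.+1%:R / n%:R ^+ 2)).
      apply: ler_sum => l l0.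
      have {}l0 : (0 < l)%N by rewrite lt0n; apply: contraNN l0 => /eqP h; apply/eqP/val_inj.
      rewrite normrM normrX normr_nat -[in X in _ ^+ X](prednK l0) exprS.
      apply: (@le_trans _ _ (C / n%:R ^+ l.+1 * (i.+1%:R * n%:R ^+ l.-1))).
        by rewrite ler_pM ?HC ?mulr_ge0 ?exprn_ge0// ler_wpM2l// lerXn2r ?nnegrE ?ler_nat.
      rewrite -{1}(prednK l0) le_eqVlt; apply/orP; left; apply/eqP.
      by rewrite !exprS; field; rewrite ?gt_eqF ?exprn_gt0.
    apply: (@le_trans _ _ (\sum_(l < p) C * i.+1%:R / n%:R ^+ 2)).
      rewrite [leRHS](bigID (fun l => l != Ordinal p0))/= lerDl sumr_ge0// => l _.
      by rewrite divr_ge0 ?mulr_ge0 ?exprn_ge0// ltW.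
    rewrite sumr_const card_ord -[_ *+ p]mulr_natl !mulrA//.
  have HT2 : p%:R * C * i.+1%:R / n%:R ^+ 2 <= (2 * n%:R)^-1.
    rewrite ler_pdivrMr ?exprn_gt0//.
    have -> : (2 * n%:R)^-1 * n%:R ^+ 2 = n%:R / 2 :> R by field; rewrite gt_eqF.
    by have := ler_wpM2r (ler0n R i.+1) Cp; lra.
  have : (2 * n%:R)^-1 = 2^-1 * n%:R^-1 :> R by rewrite invfM.
  move: HT; rewrite ler_norml => /andP[HT _]; lra.
Qed.

End RegularWeights.

(** * Recursions with norm-bounded inputs: smoothness and alignment *)

Section Feedback.
Context (R : realType) (d : nat).
Implicit Types (z r : nat -> 'rV[R]_d) (a : nat -> R) (n k K : nat).

(** The inputs are constrained through their norms alone, because the correction is an unspecified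
    approximate solver. The first [n] values of [z] are free initial data. *)
Definition feedback (gamma : R) n a z r : Prop :=
  (forall j, enorm (r j) <= gamma * enorm (z j)) /\
  (forall k, (n <= k)%N -> z k = \sum_(i < n) a i *: r (k - i.+1)%N).

Lemma feedback_bound gamma n a z r M : 0 <= gamma -> 0 <= M ->
  gamma * \sum_(i < n) `|a i| <= 1 -> feedback gamma n a z r ->
  (forall j, (j < n)%N -> enorm (z j) <= M) -> forall j, enorm (z j) <= M.
Proof.
move=> g0 M0 ga [rz zE] zM; elim/ltn_ind => k IH.
have [kn|nk] := ltnP k n; first exact: zM.
rewrite zE// (le_trans (enorm_lin_sum _ _))//.
apply: (@le_trans _ _ (\sum_(i < n) `|a i| * (gamma * M))).
  apply: ler_sum => i _; rewrite ler_wpM2l// (le_trans (rz _))// ler_wpM2l// IH//.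
  by rewrite ltn_subrL /= (leq_trans _ nk)// (leq_trans _ (ltn_ord i)).
by rewrite -big_distrl/= mulrA (mulrC _ gamma) ler_piMl.
Qed.

Lemma feedback_shift gamma n a z r k1 : feedback gamma n a z r ->
  feedback gamma n a (fun j => z (k1 + j)%N) (fun j => r (k1 + j)%N).
Proof.
move=> [rz zE]; split=> [j|k nk]; first exact: rz.
rewrite zE ?(leq_trans nk) ?leq_addl//; apply: eq_bigr => i _.
by rewrite addnBA// (leq_trans (ltn_ord i)).
Qed.

Lemma feedback_scale gamma n a z r c : feedback gamma n a z r ->
  feedback gamma n a (fun j => c *: z j) (fun j => c *: r j).
Proof.
move=> [rz zE]; split=> [j|k nk].
  by rewrite !enormZ mulrCA ler_wpM2l.
by rewrite zE// scaler_sumr; apply: eq_bigr => i _; rewrite !scalerA mulrC.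
Qed.

Section Bounded.
Variables (gamma C : R) (n : nat) (a : nat -> R) (z r : nat -> 'rV[R]_d).
Hypotheses (g0 : 0 <= gamma) (g1 : gamma < 1) (C1 : 1 <= C) (n0 : (0 < n)%N).
Hypotheses (rw : regular_weights C n a) (ga : gamma * \sum_(i < n) `|a i| <= 1).
Hypotheses (fb : feedback gamma n a z r) (z1 : forall j, enorm (z j) <= 1).

Let r_le j : enorm (r j) <= gamma.
Proof. by case: fb => rz _; rewrite (le_trans (rz j))// ler_piMr. Qed.

Let r_le1 j : enorm (r j) <= 1.
Proof. exact: le_trans (r_le j) (ltW g1). Qed.

(** The inputs need not vary slowly, so the difference is moved onto the weights: two boundary terms
    of size C/n, and fewer than n increments of size C/n^2. *)
Lemma feedback_lipS k : (n <= k)%N -> enorm (z k.+1 - z k) <= 3 * C / n%:R.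
Proof.
case: fb => _ zE nk; rewrite (zE k nk) (zE k.+1) ?(leq_trans nk)//.
have n0' : 0 < n%:R :> R by rewrite ltr0n.
case: n n0 rw nk n0' => // n' _ rw' nk n0'.
rewrite big_ord_recl [X in _ - X]big_ord_recr/= subn1/=.
have -> : \sum_(i < n') a (bump 0 i) *: r (k.+1 - (bump 0 i).+1)%N
   = \sum_(i < n') a i.+1 *: r (k - i.+1)%N by apply: eq_bigr.
set A := \sum_(i < n') _; set B := \sum_(i < n') _.
have -> : a 0%N *: r k + A - (B + a n' *: r (k - n'.+1)%N)
   = a 0%N *: r k - a n' *: r (k - n'.+1)%N + (A - B).
  by rewrite opprD [- B + _]addrC addrACA.
have AB : enorm (A - B) <= C / n'.+1%:R.
  rewrite /A /B -sumrB; under eq_bigr do rewrite -scalerBl.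
  rewrite (le_trans (enorm_lin_sum _ _))//.
  apply: (@le_trans _ _ (\sum_(i < n') C / n'.+1%:R ^+ 2 * 1)).
    by apply: ler_sum => i _; rewrite ler_pM ?r_le1//; apply: (rw_lip rw'); rewrite ltnS.
  rewrite sumr_const card_ord -[_ *+ n']mulr_natl mulr1.
  have -> : C / n'.+1%:R = n'.+1%:R * (C / n'.+1%:R ^+ 2).
    by field; rewrite gt_eqF.
  by rewrite ler_wpM2r ?ler_nat ?leqnSn// divr_ge0 ?exprn_ge0// (le_trans ler01 C1).
have E (i : nat) j : (i < n'.+1)%N -> enorm (a i *: r j) <= C / n'.+1%:R.
  by move=> ni; rewrite enormZ -[leRHS]mulr1 ler_pM ?r_le1//; apply: (rw_bound rw').
have -> : 3 * C / n'.+1%:R = C / n'.+1%:R + C / n'.+1%:R + C / n'.+1%:R by ring.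
rewrite (le_trans (enormD _ _))// lerD// (le_trans (enormB _ _))//.
by rewrite lerD// E.
Qed.

Lemma feedback_lip k s : (n <= k)%N -> enorm (z (k + s)%N - z k) <= 3 * C / n%:R * s%:R.
Proof.
move=> nk; elim: s => [|s IH]; first by rewrite addn0 subrr enorm0 mulr0.
have -> : z (k + s.+1)%N - z k = (z (k + s).+1 - z (k + s)%N) + (z (k + s)%N - z k).
  by rewrite addrA subrK addnS.
rewrite -[s.+1%:R]natr1 mulrDr mulr1 [leRHS]addrC (le_trans (enormD _ _))//.
by rewrite lerD// feedback_lipS// (leq_trans nk)// leq_addr.
Qed.

(* The deficit of [z k] from norm 1 controls how far the recent inputs are from
   being aligned with [z k]. *)
Lemma feedback_alignment k N1 : (n <= k)%N -> (N1 <= n)%N -> 2 * C * N1%:R <= n%:R ->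
  \sum_(i < N1) (gamma - dotv (z k) (r (k - i.+1)%N)) <= 2 * n%:R * (1 - enorm (z k) ^+ 2).
Proof.
move=> nk N1n N1C; have [_ zE] := fb.
have n0' : 0 < n%:R :> R by rewrite ltr0n.
have zr j : `|dotv (z k) (r j)| <= gamma.
  by rewrite (le_trans (ler_dotv_norm _ _))// -[leRHS]mul1r ler_pM.
have zrl j : dotv (z k) (r j) <= gamma by apply: le_trans (zr j); exact: ler_norm.
have H : enorm (z k) ^+ 2 = \sum_(i < n) a i * dotv (z k) (r (k - i.+1)%N).
  rewrite enorm_sqr {2}(zE k nk) dotv_sumr; apply: eq_bigr => i _; exact: dotvZr.
(* Every term of this sum is nonnegative, so it may be restricted to the first [N1] indices, where
   [a i] is at least 1/(2n). *)
have T : \sum_(i < n) (gamma * `|a i| - a i * dotv (z k) (r (k - i.+1)%N))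
    <= 1 - enorm (z k) ^+ 2.
  by rewrite sumrB -H -big_distrr/= lerD2r.
rewrite mulrC -ler_pdivrMr ?mulr_gt0// big_distrl/=; apply: le_trans T.
rewrite -!(big_mkord xpredT (fun i => gamma * `|a i| - a i * dotv (z k) (r (k - i.+1)%N))).
rewrite (@big_cat_nat _ _ _ N1)//= -[leLHS]addr0 lerD//.
  rewrite -(big_mkord xpredT (fun i => (gamma - dotv (z k) (r (k - i.+1)%N)) / (2 * n%:R))).
  rewrite !big_nat; apply: ler_sum => i /andP[_ iN].
  have ai : (2 * n%:R)^-1 <= a i.
    apply: (rw_lower rw); first exact: leq_trans N1n.
    by apply: le_trans N1C; rewrite ler_wpM2l ?ler_nat// mulr_ge0// (le_trans ler01).
  have ai0 : 0 <= a i by apply: le_trans ai; rewrite invr_ge0 mulr_ge0.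
  rewrite ger0_norm// (mulrC gamma) -mulrBr mulrC ler_wpM2r// subr_ge0//.
rewrite big_nat sumr_ge0// => i _; rewrite subr_ge0.
rewrite (le_trans (ler_norm _))// normrM mulrC ler_wpM2r//.
Qed.

End Bounded.
End Feedback.

Lemma sum_nat_sub_le (R : realType) (f : nat -> R) s w N :
  (forall i, 0 <= f i) -> (s + w <= N)%N ->
  \sum_(u < w) f (s + u)%N <= \sum_(i < N) f i.
Proof.
move=> f0 swN.
rewrite -(big_mkord xpredT f) -(big_mkord xpredT (fun u => f (s + u)%N)).
rewrite [leRHS](@big_cat_nat _ _ _ s)//=; last by apply: leq_trans swN; rewrite leq_addr.
rewrite [in leRHS](@big_cat_nat _ _ _ (s + w) s N)//= ?leq_addr//.
have <- : \sum_(s <= i < s + w) f i = \sum_(0 <= u < w) f (s + u)%N.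
  by rewrite -{1}[s]add0n big_addn addKn; apply: eq_bigr => u _; rewrite addnC.
by rewrite addrCA -[leLHS]addr0 lerD// addr_ge0// big_nat sumr_ge0.
Qed.

(** Arithmetic for [feedback_step_quant]: the n/(2c) most recent indices carry weights at least
    1/(2n), the shift s uses up at most a quarter of them, and n/e is the length of a window on
    which z drifts little. *)
Lemma window_arith (c n e K s : nat) : (0 < c)%N -> (8 * c <= e)%N -> (e <= n)%N ->
  (2 * n <= K)%N -> (s <= n %/ (8 * c))%N ->
  [/\ (s + n %/ e <= n %/ (2 * c))%N, (n <= 8 * c * (n %/ (2 * c) - s))%N,
      (n %/ (2 * c) <= n)%N & (s + n + n %/ e <= K)%N].
Proof.
move=> c0 ce en nK sn; set m := (n %/ (8 * c))%N in sn *.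
have w8 : (n %/ e <= m)%N by rewrite leq_div2l//; lia.
have m0 : (0 < m)%N by rewrite divn_gt0; lia.
have mn : (m * (8 * c) <= n)%N := leq_divM n (8 * c).
have nm : (n < m.+1 * (8 * c))%N by apply: ltn_ceil; lia.
have m4 : (4 * m <= n %/ (2 * c))%N.
  by rewrite leq_divRL; [clear -mn; lia|clear -c0; lia].
have mc : (m <= m * c)%N by rewrite leq_pmulr.
have h2 : (c <= m * c)%N by rewrite leq_pmull.
split.
- by clear -sn w8 m4; lia.
- have : (8 * c * (3 * m) <= 8 * c * (n %/ (2 * c) - s))%N.
    by rewrite leq_mul2l; apply/orP; right; clear -sn m4; lia.
  by clear -nm mc m0 h2; lia.
- exact: leq_div.
- by clear -sn w8 mn nK mc; lia.
Qed.

(** * A nearly maximal output is nearly constant over a fraction of n steps *)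

Section Step.
Context (R : realType) (d : nat).
Implicit Types (z r : nat -> 'rV[R]_d) (a : nat -> R) (n k K : nat).

(** Let k = K - s. The inputs just before k are aligned with [z K], so their norms are near gamma;
    hence the neighbouring outputs, and by the Lipschitz bound [z k] itself, have norm near 1. Then
    [z k] is also aligned with its recent inputs. At least n/(8c) of these are shared with [z K], so
    [z k + z K] has norm near 2, and the parallelogram law makes the difference small. *)
Lemma feedback_step_quant (gamma eta delta : R) (c n e K s : nat) a z r :
  0 < gamma -> gamma < 1 -> (0 < c)%N -> (8 * c <= e)%N -> (e <= n)%N ->
  regular_weights c%:R n a -> gamma * \sum_(i < n) `|a i| <= 1 ->
  feedback gamma n a z r -> (forall j, enorm (z j) <= 1) ->
  4 * e%:R * delta / gamma + 3 * c%:R / e%:R <= eta -> delta <= eta ->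
  (2 * n <= K)%N -> 1 - delta <= enorm (z K) ^+ 2 -> (s <= n %/ (8 * c))%N ->
  enorm (z (K - s)%N - z K) ^+ 2 <= 192 * c%:R / gamma * eta.
Proof.
move=> g0 g1 c0 ce en rw ga fb z1 He de nK zK sn.
set k := (K - s)%N; set N1 := (n %/ (2 * c))%N; set w := (n %/ e)%N.
have c1 : 1 <= c%:R :> R by rewrite ler1n.
have e0 : (0 < e)%N by rewrite (leq_trans _ ce)// muln_gt0 c0.
have n0 : (0 < n)%N by rewrite (leq_trans e0).
have [swN N1s N1le swK] := window_arith c0 ce en nK sn.
rewrite -/N1 -/w in swN N1s N1le swK.
have w1 : (0 < w)%N by rewrite divn_gt0.
have ew : (n <= 2 * (e * w))%N.
  by have := @ltn_ceil n e e0; rewrite -/w; clear -w1 => h; nia.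
have we : (w * e <= n)%N := leq_divM n e.
have sK : (s <= K)%N by apply: leq_trans swK; rewrite -addnA leq_addr.
have nk : (n + w <= k)%N by rewrite /k leq_subRL// addnA.
have nK' : (n <= K)%N by apply: leq_trans nK; rewrite leq_pmull.
have nk' : (n <= k)%N by apply: leq_trans nk; rewrite leq_addr.
have N1C : 2 * c%:R * N1%:R <= n%:R :> R by rewrite -!natrM ler_nat mulnC; exact: leq_divM.
have nR : 0 < n%:R :> R by rewrite ltr0n.
have wR : 0 < w%:R :> R by rewrite ltr0n.
have eR : 0 < e%:R :> R by rewrite ltr0n.
have cR : 0 < c%:R :> R by rewrite ltr0n.
have zr_le k' j : dotv (z k') (r j) <= gamma * enorm (z j).
  rewrite (le_trans (dotv_le _ _))// -[leRHS]mul1r ler_pM//; exact: (fb.1 j).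
have r1 j : enorm (r j) <= gamma.
  by rewrite (le_trans (fb.1 j))// ler_piMr// ltW.
have zr_le1 k' j : 0 <= gamma - dotv (z k') (r j).
  by rewrite subr_ge0 (le_trans (zr_le _ _))// ler_piMr// ltW.
have AK := feedback_alignment (ltW g0) c1 n0 rw ga fb z1 nK' N1le N1C.
have Ak := feedback_alignment (ltW g0) c1 n0 rw ga fb z1 nk' N1le N1C.
have KE u : (K - (s + u).+1 = k - u.+1)%N by rewrite /k -subnDA addnS.
(* The window of w = n/e indices balances two errors: the total deficit 2 n delta spread over it
   costs at most 4 e delta / gamma per index, and the drift of z across it is at most 3 c / e. *)
have zk : 1 - enorm (z k) <= eta.
  have S1 : w%:R * (gamma * (1 - enorm (z k) - 3 * c%:R / n%:R * w%:R)) <= 2 * n%:R * delta.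
    apply: (@le_trans _ _ (2 * n%:R * (1 - enorm (z K) ^+ 2))); last first.
      by rewrite ler_wpM2l ?mulr_ge0//; lra.
    apply: le_trans AK.
    apply: le_trans (sum_nat_sub_le
      (f := fun i => gamma - dotv (z K) (r (K - i.+1)%N)) (fun i => zr_le1 _ _) swN).
    rewrite mulr_natl -[X in _ *+ X]card_ord -sumr_const; apply: ler_sum => u _.
    rewrite KE; have := zr_le K (k - u.+1)%N.
    have uk' : (u < k)%N.
      by rewrite (leq_trans (ltn_ord u))// (leq_trans _ nk)// leq_addl.
    have uk : (n <= k - u.+1)%N.
      by rewrite leq_subRL// addnC (leq_trans _ nk)// leq_add2l.
    have := feedback_lip (ltW g0) g1 c1 n0 rw fb z1 u.+1 uk; rewrite subnK//.
    have : enorm (z (k - u.+1)%N) <= enorm (z k) + enorm (z k - z (k - u.+1)%N).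
      by rewrite -[X in enorm X <= _](subKr (z k)) (le_trans (enormB _ _)).
    have uw : 3 * c%:R / n%:R * u.+1%:R <= 3 * c%:R / n%:R * w%:R :> R.
      by rewrite ler_wpM2l ?divr_ge0 ?mulr_ge0// ler_nat.
    move=> h1 h2 h3.
    have h4 : gamma * enorm (z (k - u.+1)%N)
       <= gamma * (enorm (z k) + 3 * c%:R / n%:R * w%:R) by rewrite ler_wpM2l ?(ltW g0)//; lra.
    lra.
  have S2 : 1 - enorm (z k) - 3 * c%:R / n%:R * w%:R <= 4 * e%:R * delta / gamma.
    have d0 : 0 <= delta.
      have := z1 K; have : enorm (z K) ^+ 2 <= 1 by rewrite expr_le1.
      by lra.
    rewrite ler_pdivlMr// mulrC -(ler_pM2l wR) (le_trans S1)//.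
    have -> : w%:R * (4 * e%:R * delta) = 2 * delta * (2 * e%:R * w%:R) by ring.
    have -> : 2 * n%:R * delta = 2 * delta * n%:R by ring.
    by rewrite ler_wpM2l ?mulr_ge0// -!natrM ler_nat -mulnA.
  have S3 : 3 * c%:R / n%:R * w%:R <= 3 * c%:R / e%:R :> R.
    rewrite -mulrA ler_wpM2l ?mulr_ge0// ler_pdivrMl//.
    by rewrite ler_pdivlMr// -natrM ler_nat.
  lra.
have e0' : 0 <= eta by have := z1 k; have := zk; lra.
have zk2 : 1 - enorm (z k) ^+ 2 <= 2 * eta.
  have -> : 1 - enorm (z k) ^+ 2 = (1 - enorm (z k)) * (1 + enorm (z k)) by ring.
  have h : 0 <= 1 - enorm (z k) by rewrite subr_ge0.
  apply: (@le_trans _ _ (eta * 2)); last by rewrite mulrC.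
  by apply: ler_pM => //; [rewrite addr_ge0|have := z1 k; lra].
(* The [N1 - s] indices before k lie in the recent ranges of both K and k, so the two alignment sums
   can be added there term by term. *)
have S4 : (N1 - s)%N%:R * (gamma * (2 - enorm (z k + z K))) <= n%:R * (6 * eta).
  have sN : (s + (N1 - s) <= N1)%N by rewrite subnKC// (leq_trans _ swN)// leq_addr.
  have L1 := sum_nat_sub_le (f := fun i => gamma - dotv (z K) (r (K - i.+1)%N))
     (s := s) (w := (N1 - s)%N) (N := N1) (fun i => zr_le1 _ _) sN.
  have L2 := sum_nat_sub_le (f := fun i => gamma - dotv (z k) (r (k - i.+1)%N))
     (s := 0) (w := (N1 - s)%N) (N := N1) (fun i => zr_le1 _ _) (leq_subr _ _).
  have L3 : (N1 - s)%N%:R * (gamma * (2 - enorm (z k + z K))) <=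
    \sum_(u < (N1 - s)%N) (gamma - dotv (z K) (r (K - (s + u).+1)%N)) +
    \sum_(u < (N1 - s)%N) (gamma - dotv (z k) (r (k - (0 + u).+1)%N)).
    rewrite -big_split/= mulr_natl -[X in _ *+ X]card_ord -sumr_const; apply: ler_sum => u _.
    rewrite KE add0n.
    have := dotv_le (z k + z K) (r (k - u.+1)%N); rewrite dotvDl.
    have : enorm (z k + z K) * enorm (r (k - u.+1)%N) <= enorm (z k + z K) * gamma.
      by rewrite ler_wpM2l.
    lra.
  have zK2 : 1 - enorm (z K) ^+ 2 <= eta by lra.
  have := ler_wpM2l (mulr_ge0 (ler0n _ 2) (ltW nR)) zK2.
  have := ler_wpM2l (mulr_ge0 (ler0n _ 2) (ltW nR)) zk2.
  lra.
have zz : enorm (z k + z K) <= 2.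
  by have := enormD (z k) (z K); have := z1 k; have := z1 K; lra.
have S5 : gamma * (2 - enorm (z k + z K)) <= 8 * c%:R * (6 * eta).
  rewrite -(ler_pM2l nR).
  have g2 : 0 <= gamma * (2 - enorm (z k + z K)) by rewrite mulr_ge0 ?subr_ge0// ltW.
  have : n%:R * (gamma * (2 - enorm (z k + z K)))
     <= (8 * c * (N1 - s))%N%:R * (gamma * (2 - enorm (z k + z K))).
    by rewrite ler_wpM2r// ler_nat.
  rewrite 2!natrM; have := ler_wpM2l (mulr_ge0 (ler0n R 8) (ltW cR)) S4; lra.
have S6 : 2 - enorm (z k + z K) <= 48 * c%:R / gamma * eta.
  by rewrite mulrAC ler_pdivlMr//; lra.
rewrite enorm_parallelogram.
have : enorm (z k) ^+ 2 <= 1 by rewrite expr_le1.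
have : enorm (z K) ^+ 2 <= 1 by rewrite expr_le1.
have -> : 192 * c%:R / gamma * eta = 4 * (48 * c%:R / gamma * eta) by ring.
have : 4 - enorm (z k + z K) ^+ 2 <= 4 * (2 - enorm (z k + z K)).
  have : 0 <= (2 - enorm (z k + z K)) ^+ 2 by rewrite sqr_ge0.
  lra.
lra.
Qed.

End Step.

Lemma sum_shift_le (R : realType) (f : nat -> R) (g : R) L m :
  (forall v, `|f v| <= g) ->
  `|\sum_(u < L) f (u + m)%N - \sum_(u < L) f u| <= 2 * m%:R * g.
Proof.
move=> fg; elim: m => [|m IH].
  under eq_bigr do rewrite addn0.
  by rewrite subrr normr0 mulr0 mul0r.
have E : \sum_(u < L) f (u + m.+1)%N = \sum_(u < L) f (u + m)%N + (f (L + m)%N - f m).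
  have : \sum_(u < L.+1) f (u + m)%N = \sum_(u < L.+1) f (u + m)%N by [].
  rewrite {1}big_ord_recl big_ord_recr/= add0n.
  have -> : \sum_(i < L) f (bump 0 i + m)%N = \sum_(u < L) f (u + m.+1)%N.
    by apply: eq_bigr => i _; rewrite addnS.
  by move=> h; rewrite addrA -h addrAC subrr add0r.
rewrite E addrAC (le_trans (ler_normD _ _))//.
have -> : 2 * m.+1%:R * g = 2 * m%:R * g + (g + g) by rewrite -[m.+1%:R]natr1; ring.
by rewrite lerD// (le_trans (ler_normB _ _))// lerD.
Qed.

Lemma natr_ge_exists (R : realType) (x : R) : exists m : nat, x <= m%:R.
Proof. by exists (Num.truncn x).+1; rewrite ltW// truncnS_gt. Qed.

(** * Uniform contraction of the recursion *)

Section Contraction.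
Context (R : realType) (d : nat).
Implicit Types (z r : nat -> 'rV[R]_d) (a : nat -> R) (n k K : nat).

Definition unit_feedback (gamma : R) (c n : nat) a z r : Prop :=
  [/\ regular_weights c%:R n a, gamma * \sum_(i < n) `|a i| <= 1,
      feedback gamma n a z r & forall j, enorm (z j) <= 1].

Lemma feedback_step (gamma eps : R) (c : nat) :
  0 < gamma -> gamma < 1 -> (0 < c)%N -> 0 < eps ->
  exists delta : R, 0 < delta /\ exists N0 : nat, forall n a z r K s,
    (N0 <= n)%N -> unit_feedback gamma c n a z r ->
    (2 * n <= K)%N -> 1 - delta <= enorm (z K) ^+ 2 -> (s <= n %/ (8 * c))%N ->
    enorm (z (K - s)%N - z K) <= eps.
Proof.
move=> g0 g1 c0 eps0.
have cR : 0 < c%:R :> R by rewrite ltr0n.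
(* This [eta] turns the bound of [feedback_step_quant] into eps^2. Half of it pays for the drift 3 c
   / e, which fixes e; the other half pays for 4 e delta / gamma, which then fixes delta. *)
pose eta := gamma * eps ^+ 2 / (192 * c%:R).
have eta0 : 0 < eta by rewrite divr_gt0 ?mulr_gt0 ?exprn_gt0.
have [m mE] := natr_ge_exists (6 * c%:R / eta).
pose e := (8 * c + m)%N.
have eR : 0 < e%:R :> R by rewrite ltr0n addn_gt0 muln_gt0 c0.
have ec : 3 * c%:R / e%:R <= eta / 2.
  rewrite ler_pdivrMr//.
  have : 6 * c%:R <= m%:R * eta by rewrite -ler_pdivrMr.
  have : m%:R * eta <= e%:R * eta by rewrite ler_wpM2r ?ler_nat ?leq_addl// ltW.
  lra.
exists (Num.min eta (gamma * eta / (8 * e%:R))); split.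
  rewrite lt_min eta0 /=; apply: divr_gt0; apply: mulr_gt0 => //.
exists e => n a z r K s en [rw ga fb z1] nK zK sn.
have := feedback_step_quant (eta := eta) g0 g1 c0 (leq_addr _ _ : (8 * c <= e)%N)
  en rw ga fb z1 _ _ nK zK sn.
have -> : 192 * c%:R / gamma * eta = eps ^+ 2.
  by rewrite /eta; field; rewrite !gt_eqF.
rewrite ge_min lexx /= => /(_ _ isT) H.
rewrite -(@ler_pXn2r _ 2)// ?nnegrE ?(ltW eps0)//; apply: H.
set D := Num.min _ _.
have D1 : D <= gamma * eta / (8 * e%:R) by rewrite ge_min lexx orbT.
have : 4 * e%:R * D / gamma <= eta / 2.
  rewrite ler_pdivrMr//.
  have := ler_wpM2l (mulr_ge0 (ler0n R 4) (ltW eR)) D1.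
  have -> : 4 * e%:R * (gamma * eta / (8 * e%:R)) = eta / 2 * gamma.
    by field; rewrite gt_eqF.
  by [].
lra.
Qed.

(** One application of [feedback_step] reaches back n/(8c) indices and needs a norm near 1 at its
    own starting index. The tolerance d1/4 for the earlier blocks keeps the norm there large enough
    for the last one. As J is fixed before n, delta does not depend on n. *)
Lemma feedback_steps (gamma eps : R) (c J : nat) :
  0 < gamma -> gamma < 1 -> (0 < c)%N -> 0 < eps ->
  exists delta : R, 0 < delta /\ exists N0 : nat, forall n a z r K s,
    (N0 <= n)%N -> unit_feedback gamma c n a z r ->
    ((2 + J) * n <= K)%N -> 1 - delta <= enorm (z K) ^+ 2 -> (s <= J * (n %/ (8 * c)))%N ->
    enorm (z (K - s)%N - z K) <= eps.
Proof.
move=> g0 g1 c0; elim: J eps => [|J IH] eps eps0.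
  exists 1; split=> //; exists 0%N => n a z r K s _ _ _ _.
  by rewrite mul0n leqn0 => /eqP ->; rewrite subn0 subrr enorm0 ltW.
have eps2 : 0 < eps / 2 by lra.
have [d1 [d10 [N1 H1]]] := feedback_step g0 g1 c0 eps2.
have e20 : 0 < Num.min (eps / 2) (d1 / 4) by rewrite lt_min eps2; lra.
have [d2 [d20 [N2 H2]]] := IH _ e20.
exists (Num.min d2 (d1 / 2)); split; first by rewrite lt_min d20; lra.
exists (maxn N1 N2) => n a z r K s; rewrite geq_max => /andP[n1 n2] uf nK zK sJ.
set s0 := (n %/ (8 * c))%N in sJ.
have s0n : (s0 <= n)%N by exact: leq_div.
have zK2 : 1 - d2 <= enorm (z K) ^+ 2.
  by apply: le_trans zK; rewrite lerD2l lerN2 ge_min lexx.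
have zK1 : 1 - d1 / 2 <= enorm (z K) ^+ 2.
  by apply: le_trans zK; rewrite lerD2l lerN2 ge_min lexx orbT.
have nK2 : ((2 + J) * n <= K)%N by apply: leq_trans nK; rewrite leq_mul2r addnS leqnSn orbT.
have B s' : (s' <= J * s0)%N -> enorm (z (K - s')%N - z K) <= Num.min (eps / 2) (d1 / 4).
  by move=> h; apply: H2 uf nK2 zK2 _.
have [sJ'|sJ'] := leqP s (J * s0).
  by apply: le_trans (B _ sJ') _; rewrite ge_min; apply/orP; left; lra.
have := B _ (leqnn _); set k := (K - J * s0)%N; rewrite le_min => /andP[Bk Bk'].
have -> : (K - s = k - (s - J * s0))%N by rewrite /k -subnDA subnKC// ltnW.
have ks : (s - J * s0 <= s0)%N by rewrite leq_subLR -[X in (_ <= _ + X)%N]mul1n -mulnDl addn1.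
have Js : (J * s0 <= J * n)%N by rewrite leq_mul2l s0n orbT.
have nk : (2 * n <= k)%N.
  rewrite /k leq_subRL; last first.
    by apply: leq_trans nK2; rewrite mulnDl (leq_trans Js)// leq_addl.
  by apply: leq_trans nK2; rewrite mulnDl addnC leq_add2l.
have z1 : forall j, enorm (z j) <= 1 by case: uf.
have zk : 1 - d1 <= enorm (z k) ^+ 2.
  have h1 : enorm (z K) <= enorm (z k) + enorm (z k - z K).
    by rewrite -[X in enorm X <= _](subKr (z k)) (le_trans (enormB _ _)).
  have h2 : enorm (z K) ^+ 2 - enorm (z k) ^+ 2 <= d1 / 2.
    have -> : enorm (z K) ^+ 2 - enorm (z k) ^+ 2 =
      (enorm (z K) - enorm (z k)) * (enorm (z K) + enorm (z k)) by ring.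
    apply: (@le_trans _ _ (d1 / 4 * (enorm (z K) + enorm (z k)))).
      by rewrite ler_wpM2r ?addr_ge0//; lra.
    have := z1 K; have := z1 k => h3 h4.
    have -> : d1 / 2 = d1 / 4 * 2 by field.
    by rewrite ler_wpM2l//; lra.
  lra.
have := H1 _ _ _ _ _ _ n1 uf nk zk ks; set v := z (k - _)%N => hv.
have -> : v - z K = (v - z k) + (z k - z K) by rewrite addrA subrK.
by rewrite (le_trans (enormD _ _))//; lra.
Qed.

(** Inserting the recursion and exchanging sums gives a weighted sum of shifted window sums of r. A
    shift by at most n changes a window sum by at most 2 n gamma, and gamma |a|_1 <= 1 absorbs the
    weights. *)
Lemma feedback_average (gamma : R) n a z r K L :
  0 <= gamma -> \sum_(i < n) a i = 1 -> gamma * \sum_(i < n) `|a i| <= 1 ->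
  feedback gamma n a z r -> (forall j, enorm (z j) <= 1) -> (n + L <= K)%N ->
  \sum_(u < L) dotv (z K) (z (K - u)%N) <= gamma * L%:R + 2 * n%:R.
Proof.
move=> g0 a1 ga [rz zE] z1 nK.
pose rho v := dotv (z K) (r (K - v)%N).
have rho1 v : `|rho v| <= gamma.
  rewrite (le_trans (ler_dotv_norm _ _))// -[leRHS]mul1r ler_pM//.
  by rewrite (le_trans (rz _))// ler_piMr.
have -> : \sum_(u < L) dotv (z K) (z (K - u)%N)
    = \sum_(i < n) a i * \sum_(u < L) rho (u + i.+1)%N.
  under [RHS]eq_bigr do rewrite big_distrr/=.
  rewrite [RHS]exchange_big/=; apply: eq_bigr => u _; rewrite (zE (K - u)%N); last first.
    by rewrite leq_subRL; [rewrite addnC (leq_trans _ nK)// leq_add2l ltnW|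
      rewrite (leq_trans (ltnW (ltn_ord u)))// (leq_trans _ nK)// leq_addl].
  rewrite dotv_sumr; apply: eq_bigr => i _.
  by rewrite dotvZr /rho subnDA.
pose P := \sum_(u < L) rho u.
have PL : P <= gamma * L%:R.
  rewrite mulr_natr -[X in _ *+ X]card_ord -sumr_const; apply: ler_sum => u _.
  exact: le_trans (ler_norm _) (rho1 u).
apply: (@le_trans _ _ (\sum_(i < n) (a i * P + `|a i| * (2 * n%:R * gamma)))).
  apply: ler_sum => i _; rewrite -lerBlDl -mulrBr (le_trans (ler_norm _))// normrM.
  rewrite ler_wpM2l// (le_trans (sum_shift_le _ _ rho1))//.
  by rewrite ler_wpM2r// ler_wpM2l// ler_nat.
rewrite big_split/= -!big_distrl/= a1 mul1r lerD//.
have -> : (\sum_(i < n) `|a i|) * (2 * n%:R * gamma)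
  = 2 * n%:R * (gamma * \sum_(i < n) `|a i|) by ring.
by rewrite ler_piMr// mulr_ge0.
Qed.

(* If [z K] had norm almost 1, then [z] would be almost constant on a long window,
   whereas the average of [z] is that of [r], up to boundary terms, because the
   weights sum to 1. *)
Lemma unit_feedback_contract (gamma : R) (c : nat) :
  0 <= gamma -> gamma < 1 -> (0 < c)%N ->
  exists lam : R, (0 <= lam < 1) /\ exists Q N0 : nat, forall n a z r K,
    (N0 <= n)%N -> unit_feedback gamma c n a z r -> (Q * n <= K)%N ->
    enorm (z K) <= lam.
Proof.
(* The alignment estimates divide by gamma; for gamma = 0 the outputs vanish from index n on. *)
move=> g0 g1 c0; have [gE|gn0] := eqVneq gamma 0.
  exists 0; split; first by rewrite lexx ltr01.
  exists 1%N, 0%N => n a z r K _ [_ _ [rz zE] _]; rewrite mul1n => nK.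
  rewrite zE// big1 ?enorm0// => i _; apply/eqP; rewrite scaler_eq0; apply/orP; right.
  by rewrite -enorm_eq0 eq_le enorm_ge0 andbT (le_trans (rz _))// gE mul0r.
have {}g0 : 0 < gamma by rewrite lt_neqAle eq_sym gn0.
(* The window has length T n. A norm above 1 - dl/2 would force an average of at least gamma + (1 -
   gamma)/2 against the upper bound gamma + 2/T, which T (1 - gamma) > 4 excludes. In J, the factor
   16 instead of 8 pays for the rounding in n/(8c). *)
have [T0 TE] := natr_ge_exists (4 / (1 - gamma)).
pose T := T0.+1; have TR : 4 < T%:R * (1 - gamma).
  rewrite -ltr_pdivrMr ?subr_gt0//; apply: le_lt_trans TE _.
  by rewrite ltr_nat.
pose J := (16 * c * T)%N.
have e0 : 0 < (1 - gamma) / 4 by lra.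
have [d1 [d10 [N1 H1]]] := feedback_steps J g0 g1 c0 e0.
pose dl := Num.min d1 (Num.min ((1 - gamma) / 4) 1).
have d0 : 0 < dl by rewrite !lt_min d10 e0 ltr01.
have dd1 : dl <= d1 by rewrite ge_min lexx.
have dd2 : dl <= (1 - gamma) / 4 by rewrite !ge_min lexx orbT.
have dd3 : dl <= 1 by rewrite !ge_min lexx !orbT.
exists (1 - dl / 2); split; first by apply/andP; split; lra.
exists (2 + J)%N, (maxn N1 (8 * c)) => n a z r K; rewrite geq_max => /andP[n1 nc] uf nK.
have [rw ga fb z1] := uf.
rewrite leNgt; apply/negP => zK.
have {}zK : 1 - dl <= enorm (z K) ^+ 2.
  have : (1 - dl / 2) ^+ 2 <= enorm (z K) ^+ 2.
    by rewrite lerXn2r ?nnegrE// ?ltW//; lra.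
  have : 0 <= dl ^+ 2 by rewrite sqr_ge0.
  lra.
have zK1 : 1 - d1 <= enorm (z K) ^+ 2 by lra.
have near s : (s <= J * (n %/ (8 * c)))%N -> enorm (z (K - s)%N - z K) <= (1 - gamma) / 4.
  exact: H1 uf nK zK1.
have n0 : (0 < n)%N by rewrite (leq_trans _ nc)// muln_gt0.
have nR : 0 < n%:R :> R by rewrite ltr0n.
have TJ : (T * n <= J * (n %/ (8 * c)))%N.
  have h : (n <= 16 * c * (n %/ (8 * c)))%N.
    have := @ltn_ceil n (8 * c) ltac:(by rewrite muln_gt0).
    have : (0 < n %/ (8 * c))%N by rewrite divn_gt0 ?muln_gt0.
    clear; set m := (n %/ _)%N; nia.
  by rewrite /J mulnAC [(_ * T)%N]mulnC leq_mul2l h orbT.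
have TK : (n + T * n <= K)%N.
  apply: leq_trans nK; rewrite -mulSn leq_mul2r; apply/orP; right.
  by rewrite /J; clear -c0; nia.
have := feedback_average (ltW g0) (rw_sum rw) ga fb z1 TK.
suff : (T * n)%N%:R * (1 - dl - (1 - gamma) / 4) <= \sum_(u < T * n) dotv (z K) (z (K - u)%N).
  move=> h1 h2; have := le_trans h1 h2; rewrite natrM => h3.
  have : n%:R * (T%:R * ((1 - gamma) / 2)) <= n%:R * 2.
    have : T%:R * n%:R * ((1 - gamma) / 2) <= T%:R * n%:R * (1 - dl - (1 - gamma) / 4 - gamma).
      by rewrite ler_wpM2l// ?mulr_ge0//; lra.
    lra.
  rewrite ler_pM2l//; lra.
rewrite mulr_natl -[X in _ *+ X]card_ord -sumr_const; apply: ler_sum => u _.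
have := near u (leq_trans (ltnW (ltn_ord u)) TJ).
have -> : dotv (z K) (z (K - u)%N) = enorm (z K) ^+ 2 + dotv (z K) (z (K - u)%N - z K).
  by rewrite enorm_sqr -dotvDr addrCA subrr addr0.
have := ler_dotv_norm (z K) (z (K - u)%N - z K); rewrite ler_norml => /andP[h _].
have : enorm (z K) * enorm (z (K - u)%N - z K) <= enorm (z (K - u)%N - z K).
  by rewrite ler_piMl.
lra.
Qed.

End Contraction.

(** * Superposition of the responses to single sources *)

Lemma strong_rec_exists (V : Type) (v0 : V) (step : (nat -> V) -> nat -> V) :
  (forall k f g, (forall j, (j < k)%N -> f j = g j) -> step f k = step g k) ->
  exists z, forall k, z k = step z k.
Proof.
move=> stepP.
(* [F k] is a table that is correct below k; the value at k is computed from it. *)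
pose F := fix F k := if k is k'.+1 then
  fun j => if j == k' then step (F k') k' else F k' j else fun=> v0.
pose z j := F j.+1 j; exists z.
have Fz k j : (j < k)%N -> F k j = z j.
  elim: k => // k IH; rewrite ltnS leq_eqVlt => /orP[/eqP ->|jk]; first by [].
  by rewrite /= ltn_eqF// IH.
by move=> k; rewrite /z /= eqxx; apply: stepP => j jk; exact: Fz.
Qed.

Lemma sum_geometric_blocks_le (R : realType) (lam : R) q N :
  0 <= lam -> lam < 1 -> (0 < q)%N ->
  \sum_(t < N) lam ^+ (t %/ q) <= q%:R / (1 - lam).
Proof.
move=> l0 l1 q0.
have E l : (\sum_(t < l * q) lam ^+ (t %/ q)) * (1 - lam) = q%:R * (1 - lam ^+ l).
  elim: l => [|l IH]; first by rewrite mul0n big_ord0 mul0r expr0 subrr mulr0.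
  rewrite mulSnr big_split_ord/= mulrDl IH.
  have -> : \sum_(i < q) lam ^+ ((l * q + i) %/ q) = q%:R * lam ^+ l.
    rewrite (eq_bigr (fun=> lam ^+ l)) => [|i _].
      by rewrite sumr_const card_ord mulr_natl.
    by rewrite divnMDl// divn_small ?addn0.
  by rewrite exprS; ring.
rewrite ler_pdivlMr ?subr_gt0//.
have := sum_nat_sub_le (f := fun t => lam ^+ (t %/ q)) (s := 0) (w := N) (N := (N * q)%N)
  (fun i => exprn_ge0 _ l0).
rewrite add0n leq_pmulr// => /(_ isT) H.
apply: le_trans (ler_wpM2r _ H) _; first by rewrite subr_ge0 ltW.
by rewrite E ler_piMr// lerBlDr lerDl exprn_ge0.
Qed.

Section Superposition.
Context (R : realType) (d : nat).
Implicit Types (z r : nat -> 'rV[R]_d) (a : nat -> R) (n k K : nat).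

(** The contraction is iterated: after l blocks the sequence is restarted and divided by its current
    bound [lam ^+ l * M], which gives a unit feedback again. *)
Lemma feedback_decay (gamma : R) (c : nat) :
  0 <= gamma -> gamma < 1 -> (0 < c)%N ->
  exists lam : R, (0 <= lam < 1) /\ exists Q N0 : nat, (0 < Q)%N /\ forall n a z r M,
    (N0 <= n)%N -> regular_weights c%:R n a -> gamma * \sum_(i < n) `|a i| <= 1 ->
    feedback gamma n a z r -> 0 <= M -> (forall j, (j < n)%N -> enorm (z j) <= M) ->
    forall k, enorm (z k) <= lam ^+ (k %/ (Q * n)) * M.
Proof.
move=> g0 g1 c0; have [lam [/andP[l0 l1] [Q [N0 H]]]] := unit_feedback_contract d g0 g1 c0.
exists lam; split; first by rewrite l0.
exists Q.+1, N0; split=> // n a z r M nN rw ga fb M0 zM k.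
suff S l : (l * (Q.+1 * n) <= k)%N -> enorm (z k) <= lam ^+ l * M by apply: S; exact: leq_divM.
elim: l k => [|l IH] k.
  by move=> _; rewrite mul1r; exact: feedback_bound fb zM _.
move=> lk; set k1 := (l * (Q.+1 * n))%N in IH *.
have lM0 : 0 <= lam ^+ l * M by rewrite mulr_ge0 ?exprn_ge0.
have k1k : (k1 + Q * n <= k)%N.
  by apply: leq_trans lk; rewrite mulSn addnC leq_add2r leq_mul2r leqnSn orbT.
have [lM|lM] := eqVneq (lam ^+ l * M) 0.
  apply: le_trans (IH _ (leq_trans (leq_addr _ _) k1k)) _.
  by rewrite lM exprS -mulrA lM mulr0.
have lMp : 0 < lam ^+ l * M by rewrite lt_neqAle eq_sym lM.
have uf : unit_feedback gamma c n a (fun j => (lam ^+ l * M)^-1 *: z (k1 + j)%N)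
    (fun j => (lam ^+ l * M)^-1 *: r (k1 + j)%N).
  split=> //; first exact/feedback_scale/feedback_shift.
  move=> j; rewrite enormZ gtr0_norm ?invr_gt0// ler_pdivrMl// mulr1.
  by apply: IH; rewrite leq_addr.
have k1k' : (Q * n <= k - k1)%N by rewrite leq_subRL// (leq_trans _ k1k)// leq_addr.
have := H n _ _ _ _ nN uf k1k'.
rewrite subnKC ?(leq_trans _ k1k) ?leq_addr// enormZ gtr0_norm ?invr_gt0//.
by rewrite ler_pdivrMl// exprS -mulrA mulrC.
Qed.

(* The rank one map [v |-> dotv e v *: w] makes the recursion linear, so that the
   responses to different sources can be superposed. *)
Lemma linear_split (gamma xi : R) (e r : 'rV[R]_d) : 0 <= gamma -> 0 <= xi ->
  enorm r <= gamma * (enorm e + xi) ->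
  exists w : 'rV[R]_d, (forall v, enorm (dotv e v *: w) <= gamma * enorm v) /\
    enorm (r - dotv e e *: w) <= gamma * xi.
Proof.
move=> g0 xi0 rg; have [e0|en0] := eqVneq (enorm e) 0.
  exists 0; split=> [v|]; first by rewrite scaler0 enorm0 mulr_ge0.
  by rewrite scaler0 subr0; rewrite e0 add0r in rg.
have e0 : 0 < enorm e by rewrite lt_neqAle eq_sym en0 enorm_ge0.
have D0 : 0 < enorm e + xi by rewrite ltr_wpDr.
(* This choice sends e to the fraction |e| / (|e| + xi) of r and leaves xi / (|e| + xi), which is
   exactly the split of the bound gamma (|e| + xi). *)
exists ((enorm e * (enorm e + xi))^-1 *: r); split=> [v|].
  rewrite scalerA enormZ normrM (@gtr0_norm _ _^-1) ?invr_gt0 ?mulr_gt0//.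
  apply: (@le_trans _ _ ((enorm e * enorm v) / (enorm e * (enorm e + xi))
      * (gamma * (enorm e + xi)))).
    rewrite ler_pM// ?mulr_ge0 ?invr_ge0 ?mulr_ge0 ?(ltW D0)//.
    by rewrite ler_wpM2r ?ler_dotv_norm// invr_ge0 mulr_ge0 ?(ltW D0).
  rewrite le_eqVlt; apply/orP; left; apply/eqP; field.
  by rewrite !gt_eqF.
rewrite -enorm_sqr scalerA.
have -> : r - (enorm e ^+ 2 * (enorm e * (enorm e + xi))^-1) *: r = (xi / (enorm e + xi)) *: r.
  by rewrite -{1}[r]scale1r -scalerBl; congr (_ *: _); field; rewrite !gt_eqF.
rewrite enormZ ger0_norm ?divr_ge0 ?(ltW D0)//.
apply: (@le_trans _ _ (xi / (enorm e + xi) * (gamma * (enorm e + xi)))).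
  by rewrite ler_wpM2l// divr_ge0 ?(ltW D0).
by rewrite le_eqVlt; apply/orP; left; apply/eqP; field; rewrite gt_eqF.
Qed.

(* Discrete Gronwall inequality on the first window after the impulse at [m]; the factor
   1/n is what keeps the sum of the responses to all sources bounded. *)
Lemma impulse_bound (gamma C : R) n a z r m s : 0 <= gamma -> gamma < 1 -> 0 <= C ->
  (0 < n)%N -> (n <= m)%N -> regular_weights C n a ->
  (forall j, enorm (r j) <= gamma * enorm (z j)) ->
  (forall k, (k < m)%N -> z k = 0) -> enorm (z m) <= s ->
  (forall k, (m < k)%N -> z k = \sum_(i < n) a i *: r (k - i.+1)%N) ->
  forall t, (t < n)%N -> enorm (z (m + t.+1)%N) <= C * expR C / n%:R * s.
Proof.
move=> g0 g1 C0 n0 nm rw rz z0 zm zE.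
have nR : 0 < n%:R :> R by rewrite ltr0n.
have s0 : 0 <= s by apply: le_trans zm.
have Cn : 0 <= C / n%:R by rewrite divr_ge0.
have step t : enorm (z (m + t.+1)%N) <= C / n%:R * \sum_(j < t.+1) enorm (z (m + j)%N).
  rewrite zE ?addnS ?ltnS ?leq_addr// (le_trans (enorm_lin_sum _ _))//.
  apply: (@le_trans _ _ (\sum_(i < n) C / n%:R * enorm (z (m + t - i)%N))).
    apply: ler_sum => i _; rewrite subSS ler_pM ?(rw_bound rw)//.
    by rewrite (le_trans (rz _))// ler_piMl// ltW.
  rewrite -big_distrr/= ler_wpM2l//.
  have [tn|nt] := leqP t.+1 n.
    rewrite -(big_mkord xpredT (fun i => enorm (z (m + t - i)%N))).
    rewrite (@big_cat_nat _ _ _ t.+1)//= [X in _ + X]big_nat [X in _ + X]big1 ?addr0.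
      rewrite big_mkord (reindex_inj rev_ord_inj)/= le_eqVlt; apply/orP; left; apply/eqP.
      by apply: eq_bigr => i _; congr (enorm (z _)); have := ltn_ord i; clear; lia.
    by move=> i /andP[ti _]; rewrite z0 ?enorm0//; clear -ti n0 nm; lia.
  have := sum_nat_sub_le (f := fun i => enorm (z (m + t - i)%N)) (s := 0) (w := n) (N := t.+1)
     (fun=> enorm_ge0 _); rewrite add0n (ltnW nt) => /(_ isT) h; apply: le_trans h _.
  rewrite (reindex_inj rev_ord_inj)/= le_eqVlt; apply/orP; left; apply/eqP.
  by apply: eq_bigr => i _; congr (enorm (z _)); have := ltn_ord i; clear; lia.
have sums t : \sum_(j < t.+1) enorm (z (m + j)%N) <= (1 + C / n%:R) ^+ t * s.
  elim: t => [|t IH]; first by rewrite big_ord_recl big_ord0 addr0 addn0 mul1r.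
  rewrite big_ord_recr/= exprS -mulrA mulrDl mul1r lerD//.
  by rewrite (le_trans (step _))// ler_wpM2l.
have expC t : (t <= n)%N -> (1 + C / n%:R) ^+ t <= expR C.
  move=> tn; apply: (@le_trans _ _ ((1 + C / n%:R) ^+ n)).
    by rewrite ler_weXn2l// lerDl.
  have -> : expR C = expR (C / n%:R) ^+ n by rewrite -expRM_natl mulrCA divff ?gt_eqF// mulr1.
  by rewrite lerXn2r ?nnegrE ?expR_ge0 ?addr_ge0// expR_ge1Dx.
move=> t tn; rewrite (le_trans (step t))//.
have -> : C * expR C / n%:R * s = C / n%:R * (expR C * s) by ring.
by rewrite ler_wpM2l// (le_trans (sums t))// ler_wpM2r// expC// ltnW.
Qed.

(** Bound for the response at k to a unit source at m. The first summand is the source at its own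
    index. Sources below n are initial values: they lack the factor 1/n but only cause a transient.
    The decay of later ones counts from m+1, where the window of [impulse_bound] begins. *)
Definition superposition_kernel (lam D : R) (n q k m : nat) : R :=
  (k == m)%:R + (if (m < n)%N then lam ^+ (k %/ q)
                 else D / n%:R * lam ^+ ((k - m.+1) %/ q)).

Lemma superposition_kernel_ge0 lam D n q k m : 0 <= lam -> 0 <= D ->
  0 <= superposition_kernel lam D n q k m.
Proof.
move=> l0 D0; rewrite addr_ge0//.
by case: ifP; rewrite ?mulr_ge0 ?invr_ge0 ?exprn_ge0.
Qed.

(** The decay acts in blocks of Q n steps, so the geometric sum is of order n, which the factor D/n
    cancels. *)
Lemma superposition_kernel_sum (lam D : R) n Q k : 0 <= lam -> lam < 1 -> 0 <= D ->
  (0 < n)%N -> (0 < Q)%N ->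
  \sum_(m < k.+1 | (n <= m)%N) superposition_kernel lam D n (Q * n) k m
    <= 1 + D + D * Q%:R / (1 - lam).
Proof.
move=> l0 l1 D0 n0 Q0; rewrite big_split/= -addrA lerD//.
  apply: (@le_trans _ _ (\sum_(m < k.+1) (k == m)%:R)).
    rewrite [leRHS](bigID (fun m : 'I_k.+1 => (n <= m)%N))/= lerDl sumr_ge0//.
  rewrite (bigD1 ord_max)//= eqxx big1 ?addr0// => m mk.
  by apply/eqP; rewrite pnatr_eq0 eqb0 eq_sym; apply: contraNN mk => /eqP h; apply/eqP/val_inj.
have nR : 0 < n%:R :> R by rewrite ltr0n.
apply: (@le_trans _ _ (\sum_(m < k.+1) D / n%:R * lam ^+ ((k - m.+1) %/ (Q * n)))).
  rewrite [leRHS](bigID (fun m : 'I_k.+1 => (n <= m)%N))/= -[leLHS]addr0 lerD//.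
    by rewrite le_eqVlt; apply/orP; left; apply/eqP; apply: eq_bigr => m nm; rewrite ltnNge nm.
  by rewrite sumr_ge0// => m _; rewrite !mulr_ge0 ?invr_ge0 ?exprn_ge0.
(* The term m = k is split off: truncated subtraction makes its exponent 0, so it contributes D/n,
   at most D. *)
rewrite -big_distrr/= big_ord_recr/= subnS subnn div0n expr0.
rewrite mulrDr mulr1 [leLHS]addrC lerD//.
  by rewrite ler_pdivrMr// ler_peMr// ler1n.
rewrite (reindex_inj rev_ord_inj)/=.
rewrite (eq_bigr (fun t : 'I_k => lam ^+ (t %/ (Q * n)))) => [|i _]; last first.
  by congr (_ ^+ (_ %/ _)); have := ltn_ord i; clear; lia.
have := sum_geometric_blocks_le k l0 l1 (_ : 0 < Q * n)%N.
rewrite muln_gt0 Q0 n0 => /(_ isT) H.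
have := ler_wpM2l (divr_ge0 D0 (ltW nR)) H.
have -> : D / n%:R * ((Q * n)%N%:R / (1 - lam)) = D * Q%:R / (1 - lam).
  by rewrite natrM; field; rewrite !gt_eqF ?subr_gt0.
by [].
Qed.

(** The rank one maps are frozen along the given trajectory e, which turns the recursion into a
    linear one with index-dependent coefficients. Then e is the sum of the solutions started at
    single sources, and each of these is a [feedback] of its own. *)
Lemma superposition_bound (gamma : R) (c : nat) :
  0 <= gamma -> gamma < 1 -> (0 < c)%N ->
  exists lam D : R, [/\ 0 <= lam, lam < 1, 0 <= D & exists Q N0 : nat, (0 < Q)%N /\
  forall n a (e g r : nat -> 'rV[R]_d) (xi : nat -> R),
    (N0 <= n)%N -> (0 < n)%N -> regular_weights c%:R n a ->
    gamma * \sum_(i < n) `|a i| <= 1 ->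
    (forall j, 0 <= xi j) ->
    (forall j, enorm (r j) <= gamma * (enorm (e j) + xi j)) ->
    (forall k, (n <= k)%N -> e k = g k + \sum_(i < n) a i *: r (k - i.+1)%N) ->
    forall k, enorm (e k) <= \sum_(m < k.+1) superposition_kernel lam D n (Q * n) k m *
      (if (m < n)%N then enorm (e m)
       else enorm (g m) + gamma * \sum_(i < n) `|a i| * xi (m - i.+1)%N)].
Proof.
move=> g0 g1 c0; have [lam [/andP[l0 l1] [Q [N0 [Q0 H]]]]] := feedback_decay g0 g1 c0.
exists lam, (c%:R * expR c%:R); split; rewrite ?mulr_ge0 ?expR_ge0//.
exists Q, N0; split=> // n a e g r xi nN n0 rw ga xi0 rE eE.
have /choice[w wP] : forall j, exists w : 'rV[R]_d,
    (forall v, enorm (dotv (e j) v *: w) <= gamma * enorm v) /\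
    enorm (r j - dotv (e j) (e j) *: w) <= gamma * xi j.
  by move=> j; apply: linear_split.
pose s m := if (m < n)%N then e m
  else g m + \sum_(i < n) a i *:
    (r (m - i.+1)%N - dotv (e (m - i.+1)%N) (e (m - i.+1)%N) *: w (m - i.+1)%N).
have sE m : enorm (s m) <= (if (m < n)%N then enorm (e m)
       else enorm (g m) + gamma * \sum_(i < n) `|a i| * xi (m - i.+1)%N).
  rewrite /s; case: ifP => // _.
  rewrite (le_trans (enormD _ _))// lerD// (le_trans (enorm_lin_sum _ _))//.
  rewrite big_distrr/=; apply: ler_sum => i _; rewrite mulrCA ler_wpM2l//.
  exact: (wP _).2.
(* The response to source m is 0 before m, equals [s m] at m and follows the homogeneous recursion
   afterwards. Below n there is no recursion, since each initial value is a source by itself. *)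
pose step m (f : nat -> 'rV[R]_d) k := if (n <= k)%N && (m < k)%N then
   \sum_(i < n) a i *: (dotv (e (k - i.+1)%N) (f (k - i.+1)%N) *: w (k - i.+1)%N)
   else if k == m then s m else 0.
have /choice[z zP] : forall m, exists z, forall k, z k = step m z k.
  move=> m; apply: (strong_rec_exists 0) => k f h fh; rewrite /step.
  case: ifP => // /andP[nk _]; apply: eq_bigr => i _; rewrite fh//.
  by clear -nk n0; lia.
have z0 m k : (k < m)%N -> z m k = 0.
  by move=> km; rewrite zP /step ltnNge (ltnW km) andbF ltn_eqF.
have zm m : z m m = s m by rewrite zP /step ltnn andbF eqxx.
have zE m k : (n <= k)%N -> (m < k)%N -> z m k =
   \sum_(i < n) a i *: (dotv (e (k - i.+1)%N) (z m (k - i.+1)%N) *: w (k - i.+1)%N).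
  by move=> nk mk; rewrite zP /step nk mk.
have rz m j : enorm (dotv (e j) (z m j) *: w j) <= gamma * enorm (z m j).
  exact: (wP j).1.
have cut k N : (k < N)%N -> \sum_(m < N) z m k = \sum_(m < k.+1) z m k.
  move=> kN; rewrite -!(big_mkord xpredT (fun m => z m k)).
  rewrite (@big_cat_nat _ _ _ k.+1)//= [X in _ + X]big_nat [X in _ + X]big1 ?addr0//.
  by move=> m /andP[km _]; rewrite z0.
have eZ k : e k = \sum_(m < k.+1) z m k.
  elim/ltn_ind: k => k IH; have [kn|nk] := ltnP k n.
    rewrite big_ord_recr/= zm /s kn big1 ?add0r// => m _.
    by rewrite zP /step leqNgt kn/= gtn_eqF.
  rewrite big_ord_recr/= zm /s ltnNge nk/= eE//.
  rewrite (eq_bigr (fun m : 'I_k => \sum_(i < n) a i *: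
      (dotv (e (k - i.+1)%N) (z m (k - i.+1)%N) *: w (k - i.+1)%N))); last first.
    by move=> m _; rewrite zE.
  rewrite exchange_big/= addrCA -big_split/=; congr (_ + _); apply: eq_bigr => i _.
  rewrite -scaler_sumr -scaler_suml -dotv_sumr -scalerDr.
  have ki : (k - i.+1 < k)%N by clear -nk n0; lia.
  by rewrite cut// -IH// addrC subrK.
have lt_small m k : (m < n)%N -> enorm (z m k) <= lam ^+ (k %/ (Q * n)) * enorm (s m).
  move=> mn; apply: H nN rw ga _ _ _ _ => //.
    split; first by move=> j; exact: rz.
    by move=> j nj; apply: zE => //; apply: leq_trans nj.
  move=> j jn; rewrite zP /step leqNgt jn/=; case: eqP => // _; by rewrite enorm0.
have lt_large m k : (n <= m)%N -> (m < k)%N ->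
    enorm (z m k) <= c%:R * expR c%:R / n%:R * lam ^+ ((k - m.+1) %/ (Q * n)) * enorm (s m).
  move=> nm mk; pose k' := (k - m.+1)%N.
  have -> : z m k = z m (m.+1 + k')%N by rewrite subnKC.
  rewrite [X in _ <= X * _]mulrC -[leRHS]mulrA -/k'.
  have fbm : feedback gamma n a (fun j => z m (m.+1 + j)%N)
      (fun j => dotv (e (m.+1 + j)%N) (z m (m.+1 + j)%N) *: w (m.+1 + j)%N).
    split=> [j|j nj]; first exact: rz.
    rewrite zE; [|by rewrite (leq_trans nj)// leq_addl|by rewrite leq_addr].
    by apply: eq_bigr => i _; rewrite addnBA// (leq_trans _ nj).
  have M0 : 0 <= c%:R * expR c%:R / n%:R * enorm (s m).
    by rewrite mulr_ge0// divr_ge0 ?mulr_ge0 ?expR_ge0.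
  apply: (H _ _ _ _ _ nN rw ga fbm M0) => j jn; rewrite addSnnS.
  apply: (impulse_bound g0 g1 (ler0n _ c) n0 nm rw (rz m) (z0 m)) => //; first by rewrite zm.
  by move=> j' mj'; apply: zE => //; apply: leq_trans (ltnW mj').
move=> k; rewrite {1}eZ (le_trans (enorm_sum _ _ _))//; apply: ler_sum => m _.
have mk : (m <= k)%N by rewrite -ltnS.
apply: (@le_trans _ _
  (superposition_kernel lam (c%:R * expR c%:R) n (Q * n) k m * enorm (s m))); last first.
  by rewrite ler_wpM2l ?superposition_kernel_ge0// mulr_ge0 ?expR_ge0.
rewrite /superposition_kernel; case: ltnP => mn.
  rewrite (le_trans (lt_small _ _ mn))// ler_wpM2r// lerDr//.
move: mk; rewrite leq_eqVlt => /orP[/eqP km|mk].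
  rewrite km eqxx zm -[leLHS]mul1r ler_wpM2r// lerDl.
  by rewrite !mulr_ge0 ?invr_ge0 ?exprn_ge0 ?expR_ge0.
by rewrite (le_trans (lt_large _ _ mn mk))// ler_wpM2r// lerDr.
Qed.

End Superposition.

(** * Taylor approximation and the extrapolation error *)

Section HalfLineTaylor.
Context (R : realType).

(** For t > 0 the constraint 0 <= t + s holds for all small s, so the restricted filter is the
    punctured neighbourhood of 0. *)
Lemma hl_derivable_coord d (f : R -> 'rV[R]_d) (t : R) (i : 'I_d) : 0 < t ->
  hl_derivable f t -> is_derive t (1 : R) (fun s => f s 0 i : R^o) (hl_derive f t 0 i).
Proof.
move=> t0 df.
have W : (0 : R)^' `=>` within [set s : R | 0 <= t + s] (0 : R)^'.
  move=> A hA.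
  have H : \forall s \near (0 : R)^', 0 <= t + s.
    near=> s; rewrite -lerBlDl sub0r.
    have : `|s| <= t by near: s; exact: dnbhs0_le.
    by rewrite ler_norml => /andP[].
  by apply: filterS2 H hA => s /= h; apply.
have C : hl_quotient f t s @[s --> (0 : R)^'] --> hl_derive f t.
  by apply: cvg_trans df; apply: cvg_fmap2.
have D : (fun h : R => h^-1 *: (((fun s => f s 0 i : R^o) \o shift t) (h *: (1 : R)) - f t 0 i))
    @ (0 : R)^' --> (hl_derive f t 0 i : R^o).
  have := cvg_comp _ _ C (@coord_continuous R 1 d 0 i (hl_derive f t)).
  apply: cvg_trans; apply: near_eq_cvg; near=> h.
  by rewrite /= /hl_quotient !mxE /= scaler1 [h + t]addrC.
by split; [apply/cvg_ex; exists (hl_derive f t 0 i)|exact: cvg_lim D].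
Unshelve. all: by end_near. Qed.

Lemma poly_antiderivative (p : {poly R}) (x c : R) :
  exists P : {poly R}, [/\ P^`() = p, P.[x] = c & (size P <= (size p).+1)%N].
Proof.
pose A := \poly_(i < (size p).+1) (if i is j.+1 then p`_j / j.+1%:R else 0).
exists (A + (c - A.[x])%:P); split.
- apply/polyP => i; rewrite derivD derivC addr0 coef_deriv coef_poly ltnS.
  case: ltnP => ip; last by rewrite mul0rn nth_default.
  by rewrite -[LHS]mulr_natr divfK ?pnatr_eq0.
- by rewrite hornerD hornerC addrC subrK.
- rewrite (leq_trans (size_polyD _ _))// geq_max size_poly (leq_trans (size_polyC_leq1 _))//.
Qed.

(** The polynomial found for [F 1] is integrated so as to agree with [F 0] at t, and the mean value
    theorem applied to the difference gains one factor t - u. It replaces an integral remainder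
    because the q-th derivative is bounded but possibly discontinuous. *)
Lemma taylor_poly (F : nat -> R -> R) (q : nat) (B t : R) : 0 <= B ->
  (forall j (s : R), (j < q)%N -> 0 < s -> is_derive s (1 : R) (F j : R -> R^o) (F j.+1 s)) ->
  (forall s : R, 0 < s -> `|F q s| <= B) -> 0 < t ->
  exists p : {poly R}, (size p <= q)%N /\
    forall u : R, 0 < u <= t -> `|F 0%N u - p.[u]| <= B * (t - u) ^+ q.
Proof.
move=> B0; elim: q F => [|q IH] F dF FB t0.
  exists 0; rewrite size_poly0; split=> // u /andP[u0 _].
  by rewrite horner0 subr0 mulr1 FB.
have [p1 [sp1 p1P]] := IH (fun j => F j.+1) (fun j s jq => dF j.+1 s jq) FB t0.
have [P [Pd Pt sP]] := poly_antiderivative p1 t (F 0%N t).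
exists P; split; first by rewrite (leq_trans sP).
move=> u /andP[u0 ut].
pose G : R -> R := (F 0%N : R -> R^o) - (horner P : R -> R^o).
have dG (x : R) : 0 < x -> is_derive x (1 : R) (G : R -> R^o) (F 1%N x - p1.[x]).
  by move=> x0; have := dF 0%N x isT x0; rewrite -Pd => ?; exact: is_deriveB.
have GE x : G x = F 0%N x - P.[x] by [].
have cG : {within `[u, t], continuous G}.
  apply: continuous_in_subspaceT => x; rewrite inE/= in_itv/= => /andP[ux _].
  apply: differentiable_continuous; apply/derivable1_diffP.
  by have := dG x (lt_le_trans u0 ux); case.
have dGi (x : R) : x \in `]u, t[%R -> is_derive x (1 : R) (G : R -> R^o) (F 1%N x - p1.[x]).
  by rewrite in_itv/= => /andP[ux _]; apply: dG; exact: lt_trans u0 ux.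
have [c] := MVT_segment ut dGi cG.
rewrite in_itv/= => /andP[uc ct]; rewrite !GE Pt subrr sub0r => /eqP.
rewrite eqr_oppLR => /eqP ->; rewrite normrN normrM (@ger0_norm _ (t - u)) ?subr_ge0//.
rewrite exprSr mulrA ler_wpM2r ?subr_ge0//.
rewrite (le_trans (p1P c _))//; first by rewrite ct (lt_le_trans u0).
by rewrite ler_wpM2l// lerXn2r ?nnegrE ?subr_ge0// lerD2l lerN2.
Qed.

(** P(x - y h) is a polynomial in y of degree below p; the moment conditions pick out its value at y
    = 0. *)
Lemma prweight_poly p n (P : {poly R}) (x h : R) : (0 < p <= n)%N -> (size P <= p)%N ->
  \sum_(i < n) prweight R p n i * P.[x - i.+1%:R * h] = P.[x].
Proof.
move=> /andP[p0 pn] sP; pose Q := P \Po (x%:P - h *: 'X).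
have sQ : (size Q <= p)%N.
  rewrite (leq_trans (size_comp_poly_leq _ _))//.
  have : (size (x%:P - h *: 'X)%R <= 2)%N.
    rewrite (leq_trans (size_polyD _ _))// geq_max size_polyN.
    rewrite (leq_trans (size_polyC_leq1 _))//=.
    by rewrite (leq_trans (size_scale_leq _ _))// size_polyX.
  by case: (size P) sP p0 => [|m]; case: (size (x%:P - _)) => [|[|[|]]]//=; lia.
have QE y : Q.[y] = P.[x - y * h] by rewrite horner_comp !hornerE mulrC.
transitivity Q.[0]; last by rewrite QE mul0r subr0.
under eq_bigr => i _ do rewrite prweightE -QE (horner_coef_wide _ sQ) big_distrr/=.
rewrite exchange_big/= (horner_coef_wide _ sQ); apply: eq_bigr => j _.
under eq_bigr do rewrite mulrCA.
by rewrite -big_distrr/= pralpha_moment// expr0n.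
Qed.

(** As q <= p, the weights are exact on the Taylor polynomial, so only the remainders at the n past
    nodes survive. Working coordinatewise costs the factor d, and [n < k] keeps every node at a
    positive time. *)
Lemma prediction_bias d p q n (f : R -> 'rV[R]_d) (B h : R) (k : nat) :
  (0 < p <= n)%N -> (0 < q <= p)%N -> 0 < h -> (n < k)%N ->
  hl_n_derivable q f -> (forall s, 0 <= s -> enorm (hl_deriven q f s) <= B) ->
  enorm (\sum_(i < n) prweight R p n i *: f ((k - i.+1)%N%:R * h) - f (k%:R * h))
   <= d%:R * ((\sum_(i < n) `|prweight R p n i|) * (B * (n%:R * h) ^+ q)).
Proof.
move=> np /andP[q0 qp] h0 nk df fB.
have B0 : 0 <= B by apply: le_trans (fB 0 (lexx 0)); exact: enorm_ge0.
have k0 : 0 < k%:R * h by rewrite mulr_gt0// ltr0n (leq_trans _ nk).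
rewrite (le_trans (enorm_le_sum _))// [leRHS]mulr_natl -[X in _ <= _ *+ X]card_ord -sumr_const.
apply: ler_sum => c _.
have [P [sP PP]] := @taylor_poly (fun j s => hl_deriven j f s 0 c) q B (k%:R * h) B0
  (fun j s jq s0 => hl_derivable_coord c s0 (df j jq s (ltW s0)))
  (fun s s0 => le_trans (ler_coord_enorm _ _) (fB s (ltW s0))) k0.
have kE (i : 'I_n) : ((k - i.+1)%N%:R : R) * h = k%:R * h - i.+1%:R * h.
  by rewrite natrB ?mulrBl// (leq_trans (ltn_ord i))// ltnW.
have Pk : P.[k%:R * h] = f (k%:R * h) 0 c.
  have := PP (k%:R * h); rewrite lexx k0 => /(_ isT).
  by rewrite subrr expr0n gtn_eqF// mulr0 normr_le0 subr_eq0 => /eqP <-.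
rewrite !mxE summxE -Pk -(prweight_poly _ h np (leq_trans sP qp)) -sumrB.
rewrite (le_trans (ler_norm_sum _ _ _))// big_distrl/=; apply: ler_sum => i _.
rewrite mxE -mulrBr normrM ler_wpM2l// kE.
have ih : 0 <= i.+1%:R * h <= n%:R * h.
  by rewrite mulr_ge0 ?(ltW h0)//= ler_wpM2r ?(ltW h0)// ler_nat.
have /andP[ih0 ihn] := ih.
rewrite (le_trans (PP _ _))//.
  rewrite gerBl ih0 andbT subr_gt0 (le_lt_trans ihn)// ltr_pM2r// ltr_nat//.
by rewrite opprB addrC subrK ler_wpM2l// lerXn2r ?nnegrE// (le_trans ih0).
Qed.

End HalfLineTaylor.

(** * Independence and vanishing covariances *)

Section Independence.
Context (R : realType) (d d' : measure_display) (T : measurableType d)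
  (T' : measurableType d') (P : probability T R) (X : nat -> {mfun T >-> T'}).
Hypothesis indep : mutually_independent P (fun k => X k).

Lemma indep_pair i j (A B : set T') : i != j -> measurable A -> measurable B ->
  P (X i @^-1` A `&` X j @^-1` B) = (P (X i @^-1` A) * P (X j @^-1` B))%E.
Proof.
move=> ij mA mB.
have := indep (J := [fset i; j]%fset) (A := fun k => if k == i then A else B).
have -> : \bigcap_(k in [set` [fset i; j]%fset]) (X k @^-1` (if k == i then A else B))
    = X i @^-1` A `&` X j @^-1` B.
  apply/seteqP; split => w.
    move=> h; split.
      by have := h i; rewrite /= !inE eqxx /= => /(_ isT).
    by have := h j; rewrite /= !inE eqxx orbT eq_sym (negPf ij) /= => /(_ isT).
  move=> [wA wB] k /=; rewrite !inE => /orP[/eqP ->|/eqP ->]; first by rewrite eqxx.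
  by rewrite eq_sym (negPf ij).
move=> ->; last by move=> k _; case: ifP.
rewrite big_fsetU1 ?inE//= big_seq_fset1 eqxx eq_sym (negPf ij) EFinM !fineK//.
all: apply: fin_num_measure; rewrite -[_ @^-1` _]setTI; exact: measurable_funP.
Qed.

(** Independence identifies the joint law with the product measure on rectangles, hence everywhere;
    Fubini then factors the integral. *)
Lemma indep_expectation_mul i j (u v : T' -> R) : i != j ->
  measurable_fun setT u -> measurable_fun setT v ->
  (u \o X i) \in Lfun P 1 -> (v \o X j) \in Lfun P 1 ->
  ((u \o X i) * (v \o X j))%R \in Lfun P 1 ->
  ('E_P[((u \o X i) * (v \o X j))%R] = 'E_P[u \o X i] * 'E_P[v \o X j])%E.
Proof.
move=> ij mu mv /Lfun1_integrable ui /Lfun1_integrable vj /Lfun1_integrable uv.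
rewrite unlock.
pose phi w := (X i w, X j w).
have mphi : measurable_fun setT phi by exact: measurable_fun_pair.
pose f (z : T' * T') : \bar R := (u z.1 * v z.2)%:E.
have mf : measurable_fun setT f.
  by apply/measurable_EFinP; apply: measurable_funM; exact: measurableT_comp.
have mu' : measurable_fun setT (EFin \o u) by exact/measurable_EFinP.
have mv' : measurable_fun setT (EFin \o v) by exact/measurable_EFinP.
pose m1 := distribution P (X i); pose m2 := distribution P (X j).
have E A : measurable A -> pushforward P phi A = (m1 \x m2)%E A.
  move=> mA; apply/esym.
  pose m' := distribution P (mfun_Sub (mem_set mphi)).
  apply: (@product_measure_unique _ _ _ _ _ m1 m2 m') => // B C mB mC.
  exact: indep_pair.
have i1 : (pushforward P phi).-integrable setT f.
  by apply: integrable_pushforward => //; exact: uv.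
have i12 : (m1 \x m2)%E.-integrable setT f.
  move/integrableP: i1 => [_ i1]; apply/integrableP; split=> //.
  by rewrite -(eq_measure_integral _ (fun A mA _ => E A mA)).
transitivity (\int[m1 \x m2]_z f z)%E.
  rewrite -(eq_measure_integral _ (fun A mA _ => E A mA)).
  by rewrite integral_pushforward.
rewrite -integral12_prod_meas1//.
have um : m1.-integrable setT (EFin \o u) by exact: integrable_pushforward.
have vm : m2.-integrable setT (EFin \o v) by exact: integrable_pushforward.
have cfin : (\int[m2]_y (v y)%:E)%E \is a fin_num by exact: integrable_fin_num vm.
transitivity (\int[m1]_x ((u x)%:E * (fine (\int[m2]_y (v y)%:E))%:E))%E.
  apply: eq_integral => x _; rewrite fineK// /fubini_F/= -integralZl//.
rewrite (integralZr _ um)// fineK//.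
by congr (_ * _)%E; exact: integral_distribution.
Qed.

Lemma indep_covariance0 i j (u v : T' -> R) : i != j ->
  measurable_fun setT u -> measurable_fun setT v ->
  (u \o X i) \in Lfun P 2%:E -> (v \o X j) \in Lfun P 2%:E ->
  covariance P (u \o X i) (v \o X j) = 0%E.
Proof.
move=> ij mu mv ui vj.
have Pfin : P setT \is a fin_num := fin_num_measure P _ measurableT.
have u1 := Lfun_subset12 Pfin ui; have v1 := Lfun_subset12 Pfin vj.
have uv := Lfun2_mul_Lfun1 ui vj.
rewrite covarianceE// indep_expectation_mul// subee// fin_numM//; exact: expectation_fin_num.
Qed.

End Independence.

(** * Second moments and the averaged sampling noise *)

Section SquareIntegrable.
Context (R : realType) (d : measure_display) (T : measurableType d) (P : probability T R).
Local Open Scope ereal_scope.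

(** Integrates the pointwise inequality f <= f^2 / (2 (D + e)) + (D + e) / 2; the extra e > 0 covers
    D = 0. *)
Lemma expectation_le_sqrt (f : T -> R) (D : R) : measurable_fun setT f ->
  (forall w, 0 <= f w)%R -> (0 <= D)%R -> 'E_P[fun w => (f w ^+ 2)%R] <= (D ^+ 2)%:E ->
  'E_P[f] <= D%:E.
Proof.
move=> mf f0 D0 fD; apply/lee_addgt0Pr => e e0.
have De : (0 < D + e)%R by rewrite ltr_wpDl.
have mf2 : measurable_fun setT (fun w => (f w ^+ 2)%R) by exact: measurable_funX.
pose g w := ((2 * (D + e))^-1 * f w ^+ 2 + (D + e) / 2)%R.
have mg : measurable_fun setT g by apply: measurable_funD => //; exact: measurable_funM.
have c0 : (0 <= (2 * (D + e))^-1)%R by rewrite invr_ge0 mulr_ge0// ltW.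
have c1 : (0 <= (D + e) / 2)%R by rewrite divr_ge0// ltW.
have g0 w : (0 <= g w)%R by rewrite addr_ge0// mulr_ge0// sqr_ge0.
apply: (@le_trans _ _ 'E_P[g]).
  apply: expectation_le => //; apply: aeW => w.
  have -> : f w = (g w - (2 * (D + e))^-1 * (f w - (D + e)) ^+ 2)%R.
    by rewrite /g; field; rewrite gt_eqF.
  by rewrite gerBl mulr_ge0// sqr_ge0.
rewrite unlock; under eq_integral do rewrite EFinD EFinM.
rewrite ge0_integralD//=; last 2 first.
  by move=> w _; rewrite mule_ge0 ?lee_fin ?sqr_ge0.
  by apply/measurable_EFinP; exact: measurable_funM.
rewrite integral_cst// [X in _ * X](_ : _ = 1); last exact: probability_setT.
rewrite mule1 ge0_integralZl//; last 2 first.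
  exact/measurable_EFinP.
  by move=> w _; rewrite lee_fin sqr_ge0.
rewrite unlock in fD.
apply: (@le_trans _ _ (((2 * (D + e))^-1 * D ^+ 2)%:E + ((D + e) / 2)%:E)).
  by rewrite leeD2r// EFinM lee_wpmul2l// lee_fin.
rewrite -!EFinD lee_fin.
have : ((2 * (D + e))^-1 * D ^+ 2 <= D / 2)%R.
  by rewrite ler_pdivrMl ?mulr_gt0// expr2 -mulrA; nra.
lra.
Qed.

Lemma Lfun2_of_expectation (f : T -> R) : measurable_fun setT f ->
  'E_P[fun w => (f w ^+ 2)%R] < +oo -> f \in Lfun P 2%:E.
Proof.
move=> mf ff; apply/andP; rewrite !inE; split=> //.
rewrite /finite_norm unlock /=.
rewrite poweR_lty//.
apply: le_lt_trans ff; rewrite unlock.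
rewrite le_eqVlt; apply/orP; left; apply/eqP; apply: eq_integral => w _.
by rewrite powR_mulrn// real_normK// num_real.
Qed.

Section WeightedSum.
Variables (X : nat -> T -> R) (a : nat -> R) (n : nat).
Hypothesis X2 : forall i, X i \in Lfun P 2%:E.

Let S k : T -> R := fun w => (\sum_(i < k) a i * X i w)%R.

Let SS k : S k.+1 = (S k \+ (a k \o* X k))%R.
Proof. by apply/funext => w; rewrite /S big_ord_recr/= [(X k w * _)%R]mulrC. Qed.

Let aX2 k : (a k \o* X k)%R \in Lfun P 2%:E.
Proof. by apply: Lfun_scale; rewrite ?ler1n. Qed.

Lemma Lfun2_weighted_sum k : S k \in Lfun P 2%:E.
Proof.
elim: k => [|k IH].
  have -> : S 0 = cst 0%R by apply/funext => w; rewrite /S big_ord0.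
  exact: Lfun_cst.
by rewrite SS rpredD ?lee1n.
Qed.

Hypothesis cov0 : forall i j, (i < j < n)%N -> covariance P (X i) (X j) = 0.

Lemma variance_weighted_sum :
  'V_P[S n] = (\sum_(i < n) a i ^+ 2 * fine 'V_P[X i])%:E.
Proof.
have Pfin : P setT \is a fin_num := fin_num_measure P _ measurableT.
have C k j : (k <= j < n)%N -> covariance P (S k) (X j) = 0.
  elim: k => [|k IH] /andP[kj jn].
    have -> : S 0 = cst 0%R by apply/funext => w; rewrite /S big_ord0.
    exact: covariance_cst_l.
  rewrite SS covarianceDl//; last exact: Lfun2_weighted_sum.
  rewrite IH ?(ltnW kj)// add0e covarianceZl ?Lfun2_mul_Lfun1 ?Lfun_subset12//.
  by rewrite cov0 ?kj// mule0.
suff V k : (k <= n)%N -> 'V_P[S k] = (\sum_(i < k) a i ^+ 2 * fine 'V_P[X i])%:E by exact: V.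
elim: k => [|k IH] kn.
  have -> : S 0 = cst 0%R by apply/funext => w; rewrite /S big_ord0.
  by rewrite big_ord0 variance_cst.
have Sk := Lfun2_weighted_sum k.
rewrite SS varianceD// IH ?(ltnW kn)// covarianceC covarianceZl; last 3 first.
- by rewrite Lfun_subset12.
- by rewrite Lfun_subset12.
- by rewrite Lfun2_mul_Lfun1.
rewrite covarianceC C ?leqnn// !mule0 adde0 varianceZ// big_ord_recr/=.
rewrite [RHS]EFinD; congr (_ + _); rewrite [RHS]EFinM fineK// variance_fin_num//.
Qed.

End WeightedSum.

Lemma variance_le_sqr (X : T -> R) (c : R) : X \in Lfun P 2%:E ->
  'V_P[X] <= 'E_P[fun w => ((X w - c) ^+ 2)%R].
Proof.
move=> X2; rewrite -(varianceB_cst_r c X2).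
have Xc : (X \- cst c)%R \in Lfun P 2%:E.
  have cc : (cst (- c)%R : T -> R) \in Lfun P 2%:E by exact: Lfun_cst.
  by rewrite -[(X \- cst c)%R]/(X \+ cst (- c))%R rpredD ?lee1n.
have Pfin : P setT \is a fin_num := fin_num_measure P _ measurableT.
have := expectation_fin_num (Lfun_subset12 Pfin Xc).
rewrite varianceE//; set m := 'E_P[(X \- cst c)%R] => mfin.
by rewrite leeBlDr ?fin_numX// leeDl// sqre_ge0.
Qed.

End SquareIntegrable.

Lemma measurable_coord (R : realType) (d : nat) (i : 'I_d) :
  measurable_fun setT (fun v : borel R d => (v : 'rV[R]_d) 0 i).
Proof.
apply: (measurability _ (RGenOpens.measurableE R)) => _ [_ [a [b ->] <-]].
rewrite setTI; apply: sub_sigma_algebra.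
by move: (@coord_continuous R 1 d 0 i) => /continuousP; apply; exact: interval_open.
Qed.

Lemma measurable_enorm (R : realType) (d : nat) (disp : measure_display)
    (T : measurableType disp) (f : T -> 'rV[R]_d) :
  (forall i, measurable_fun setT (fun w => f w 0 i)) -> measurable_fun setT (fun w => enorm (f w)).
Proof.
move=> mf; rewrite /enorm /dotv.
apply: (@measurableT_comp _ _ _ _ _ _ (@Num.sqrt R)).
  by apply: continuous_measurable_fun; exact: sqrt_continuous.
by apply: measurable_sum => i; exact: measurable_funM.
Qed.

Section WeightedSumMean.
Context (R : realType) (d : measure_display) (T : measurableType d) (P : probability T R).
Local Open Scope ereal_scope.

Lemma expectation_weighted_sum (X : nat -> T -> R) (a : nat -> R) n :
  (forall i, X i \in Lfun P 2%:E) ->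
  'E_P[fun w => (\sum_(i < n) a i * X i w)%R] = (\sum_(i < n) a i * fine 'E_P[X i])%:E.
Proof.
move=> X2; have Pfin : P setT \is a fin_num := fin_num_measure P _ measurableT.
elim: n => [|n IH].
  under [X in 'E__[X]]eq_fun do rewrite big_ord0.
  by rewrite expectation_cst big_ord0.
have -> : (fun w => \sum_(i < n.+1) a i * X i w)%R
  = ((fun w => \sum_(i < n) a i * X i w) \+ (a n \o* X n))%R.
  by apply/funext => w; rewrite big_ord_recr/= [(X n w * _)%R]mulrC.
rewrite expectationD; last 2 first.
- by rewrite Lfun_subset12// Lfun2_weighted_sum.
- by rewrite Lfun_scale// Lfun_subset12.
rewrite IH big_ord_recr/= EFinD EFinM; congr (_ + _).
by rewrite expectationZl ?Lfun_subset12// fineK// expectation_fin_num// Lfun_subset12.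
Qed.

End WeightedSumMean.

Section NoiseAverage.
Context (R : realType) (d dy : nat) (disp : measure_display) (T : measurableType disp)
  (P : probability T R) (y : nat -> {mfun T >-> borel R dy})
  (xhs : {mfun borel R dy >-> borel R d}) (xs : nat -> 'rV[R]_d) (D1 D2 : R).
Hypothesis indep : mutually_independent P (fun k => y k).
Hypotheses (D20 : 0 <= D2).
Hypothesis bias : forall k, enorm (vexpectation P (fun w => xhs (y k w)) - xs k) <= D1.
Hypothesis second_moment : forall k,
  ('E_P[fun w => (enorm ((xhs (y k w) : 'rV[R]_d) - xs k) ^+ 2)%R] <= (D2 ^+ 2)%:E)%E.

Let u (c : 'I_d) (v : borel R dy) : R := (xhs v : 'rV[R]_d) 0 c.

Let mu c : measurable_fun setT (u c).
Proof. exact: (measurableT_comp (measurable_coord c) (measurable_funP xhs)). Qed.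

Let mX c k : measurable_fun setT (u c \o y k).
Proof. exact: (measurableT_comp (mu c) (measurable_funP (y k))). Qed.

Lemma measurable_sample_error k :
  measurable_fun setT (fun w => enorm ((xhs (y k w) : 'rV[R]_d) - xs k)).
Proof.
apply: measurable_enorm => c.
under eq_fun do rewrite !mxE.
by apply: measurable_funB => //; exact: mX.
Qed.

Lemma sample_error_expectation k :
  ('E_P[fun w => enorm ((xhs (y k w) : 'rV[R]_d) - xs k)] <= D2%:E)%E.
Proof.
by apply: expectation_le_sqrt => //; exact: measurable_sample_error.
Qed.

Let X2 c k : (u c \o y k) \in Lfun P 2%:E.
Proof.
have -> : u c \o y k = ((fun w => u c (y k w) - xs k 0 c) \+ cst (xs k 0 c))%R.
  by apply/funext => w /=; rewrite subrK.
have m1 : measurable_fun setT (fun w => u c (y k w) - xs k 0 c).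
  by apply: measurable_funB => //; exact: mX.
have h1 : (fun w => u c (y k w) - xs k 0 c) \in Lfun P 2%:E.
  apply: Lfun2_of_expectation => //.
  apply: le_lt_trans (le_lt_trans (second_moment k) (ltry _)).
  apply: expectation_le => //.
  - exact: measurable_funX.
  - by apply: measurable_funX; exact: measurable_sample_error.
  - by move=> w; rewrite sqr_ge0.
  - by move=> w; rewrite sqr_ge0.
  - apply: aeW => w.
    rewrite -[leLHS]real_normK ?num_real// lerXn2r ?nnegrE//.
    by have := ler_coord_enorm ((xhs (y k w) : 'rV[R]_d) - xs k) c; rewrite !mxE.
have h2 : (cst (xs k 0 c) : T -> R) \in Lfun P 2%:E by exact: Lfun_cst.
by rewrite rpredD ?lee1n.
Qed.

Lemma sample_variance_sum k : \sum_(c < d) fine ('V_P[u c \o y k])%E <= D2 ^+ 2.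
Proof.
rewrite -lee_fin; apply: le_trans (second_moment k).
rewrite -sumEFin.
under [X in ('E__[X])%E]eq_fun do rewrite enorm_sqrE.
apply: (@le_trans _ _ (\sum_(c < d) 'E_P[fun w => (((u c \o y k) w - xs k 0 c) ^+ 2)%R])%E).
  by apply: lee_sum => c _; rewrite fineK ?variance_fin_num// variance_le_sqr.
rewrite expectation.unlock.
rewrite [leRHS](_ : _ =
  \int[P]_w (\sum_(c < d) (((u c \o y k) w - xs k 0 c) ^+ 2)%:E)%E)%E; last first.
  by apply: eq_integral => w _; rewrite -sumEFin; apply: eq_bigr => c _; rewrite !mxE.
rewrite ge0_integral_sum//.
  move=> c; apply/measurable_EFinP; apply: measurable_funX.
  by apply: measurable_funB => //; exact: mX.
by move=> c w _; rewrite lee_fin sqr_ge0.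
Qed.

(** Each sample is centred at its own mean. The means contribute the bias, weighted by the l1 norm;
    the centred parts are uncorrelated, so their variances add up and only the l2 norm of the
    weights appears. *)
Lemma noise_average (a : nat -> R) n k : (n <= k)%N ->
  ('E_P[fun w => enorm (\sum_(i < n) a i *:
      ((xhs (y (k - i.+1)%N w) : 'rV[R]_d) - xs (k - i.+1)%N))]
   <= ((\sum_(i < n) `|a i|) * D1 + Num.sqrt (\sum_(i < n) a i ^+ 2) * D2)%:E)%E.
Proof.
move=> nk; pose j i := (k - i.+1)%N.
pose m i := vexpectation P (fun w => xhs (y (j i) w)).
pose V w := \sum_(i < n) a i *: ((xhs (y (j i) w) : 'rV[R]_d) - m i).
pose b := \sum_(i < n) a i *: (m i - xs (j i)).
have split_sum w : \sum_(i < n) a i *: ((xhs (y (j i) w) : 'rV[R]_d) - xs (j i)) = V w + b.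
  rewrite /V /b -big_split/=; apply: eq_bigr => i _.
  by rewrite -scalerDr addrA subrK.
have b1 : enorm b <= (\sum_(i < n) `|a i|) * D1.
  rewrite (le_trans (enorm_lin_sum _ _))// big_distrl/=; apply: ler_sum => i _.
  by rewrite ler_wpM2l//; exact: bias.
have Vc w c : V w 0 c = \sum_(i < n) a i * (u c \o y (j i)) w
    - \sum_(i < n) a i * fine ('E_P[u c \o y (j i)])%E.
  rewrite /V summxE -sumrB; apply: eq_bigr => i _.
  by rewrite !mxE mulrBr.
have mV c : measurable_fun setT (fun w => V w 0 c).
  under eq_fun do rewrite Vc.
  apply: measurable_funB => //; apply: measurable_sum => i.
  by apply: measurable_funM => //; exact: mX.
have mVn := measurable_enorm mV.
set D := Num.sqrt _ * D2.
have D0 : 0 <= D by rewrite mulr_ge0// sqrtr_ge0.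
have VD : ('E_P[fun w => enorm (V w)] <= D%:E)%E.
  apply: expectation_le_sqrt => //.
  under [X in ('E__[X])%E]eq_fun do rewrite enorm_sqrE.
  have -> : ('E_P[fun w => (\sum_(c < d) V w 0 c ^+ 2)%R]
      = (\sum_(c < d) 'V_P[fun w => (\sum_(i < n) a i * (u c \o y (j i)) w)%R]))%E.
    transitivity (\sum_(c < d) 'E_P[fun w => (V w 0 c ^+ 2)%R])%E.
      rewrite expectation.unlock.
      under eq_integral do rewrite -sumEFin.
      rewrite ge0_integral_sum//.
        by move=> c; apply/measurable_EFinP; exact: measurable_funX.
      by move=> c w _; rewrite lee_fin sqr_ge0.
    apply: eq_bigr => c _; rewrite /variance [in RHS]covariance.unlock; congr expectation.
    apply/funext => w; rewrite Vc expr2.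
    by rewrite (expectation_weighted_sum _ _ (fun i => X2 c (j i))).
  rewrite (eq_bigr
    (fun c => (\sum_(i < n) a i ^+ 2 * fine ('V_P[u c \o y (j i)])%E)%:E)); last first.
    move=> c _; apply: (variance_weighted_sum a (fun i => X2 c (j i))) => i i' /andP[ii' i'n].
    (* As n <= k, truncated subtraction never identifies two of the indices. *)
    apply: (indep_covariance0 indep) => //; last by clear -ii' i'n nk; rewrite /j; lia.
  rewrite sumEFin lee_fin exchange_big/=.
  rewrite /D exprMn sqr_sqrtr; last by rewrite sumr_ge0// => i _; rewrite sqr_ge0.
  rewrite big_distrl/=; apply: ler_sum => i _.
  by rewrite -big_distrr/= ler_wpM2l ?sqr_ge0// sample_variance_sum.
under [X in ('E__[X])%E]eq_fun do rewrite split_sum.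
apply: (@le_trans _ _ ('E_P[fun w => (enorm (V w) + enorm b)%R])%E).
  apply: expectation_le => //.
  - apply: measurable_enorm => c; under eq_fun do rewrite mxE.
    exact: measurable_funD.
  - exact: measurable_funD.
  - by move=> w; rewrite addr_ge0.
  - by apply: aeW => w; exact: enormD.
rewrite expectation.unlock; under eq_integral do rewrite EFinD.
rewrite ge0_integralD//=; last 3 first.
- by move=> w _; rewrite lee_fin.
- exact/measurable_EFinP.
- by move=> w _; rewrite lee_fin.
rewrite integral_cst// [X in (_ + _ * X)%E](_ : _ = 1%E); last exact: probability_setT.
rewrite expectation.unlock in VD.
by rewrite mule1 addrC EFinD leeD// lee_fin.
Qed.

End NoiseAverage.

(** * Expectations of nonnegative functions, upper limits and Theta bounds *)

Section NonnegativeExpectation.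
Context (R : realType) (d : measure_display) (T : measurableType d) (P : probability T R).

Lemma expectation_lin_le n (c : 'I_n -> R) (f : 'I_n -> T -> R) (M : 'I_n -> R) :
  (forall i, 0 <= c i) -> (forall i, measurable_fun setT (f i)) ->
  (forall i w, 0 <= f i w) -> (forall i, ('E_P[f i] <= (M i)%:E)%E) ->
  ('E_P[fun w => (\sum_(i < n) c i * f i w)%R] <= (\sum_(i < n) c i * M i)%:E)%E.
Proof.
move=> c0 mf f0 fM; rewrite expectation.unlock.
under eq_integral do rewrite -sumEFin.
rewrite ge0_integral_sum//; last 2 first.
- by move=> i; apply/measurable_EFinP; exact: measurable_funM.
- by move=> i w _; rewrite lee_fin mulr_ge0.
rewrite -sumEFin; apply: lee_sum => i _.
under eq_integral do rewrite EFinM.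
rewrite ge0_integralZl//.
- by rewrite EFinM lee_wpmul2l ?lee_fin//; have := fM i; rewrite expectation.unlock.
- exact/measurable_EFinP.
- by move=> w _; rewrite lee_fin.
- by rewrite lee_fin.
Qed.

Lemma expectation_add_le (f g : T -> R) (a b : R) :
  measurable_fun setT f -> measurable_fun setT g ->
  (forall w, 0 <= f w) -> (forall w, 0 <= g w) ->
  ('E_P[f] <= a%:E)%E -> ('E_P[g] <= b%:E)%E ->
  ('E_P[fun w => (f w + g w)%R] <= (a + b)%:E)%E.
Proof.
move=> mf mg f0 g0 fa gb; rewrite expectation.unlock in fa gb *.
under eq_integral do rewrite EFinD.
rewrite ge0_integralD//=; first by rewrite EFinD leeD.
all: try by move=> w _; rewrite lee_fin.
all: exact/measurable_EFinP.
Qed.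

Lemma expectation_cst_le (c : R) : ('E_P[fun=> c] <= c%:E)%E.
Proof. by rewrite expectation_cst. Qed.

End NonnegativeExpectation.

Lemma limn_esup_le_eventually (R : realType) (e : nat -> \bar R) (A : R) :
  (forall eta : R, 0 < eta -> exists K : nat, forall k, (K <= k)%N -> (e k <= (A + eta)%:E)%E) ->
  (limn_esup e <= A%:E)%E.
Proof.
move=> H; apply/lee_addgt0Pr => eta eta0; have [K HK] := H _ eta0.
rewrite limn_esup_lim; apply: lime_le; first exact: is_cvg_esups.
near=> k; apply: ub_ereal_sup => _ [j /= kj <-]; rewrite -EFinD; apply: HK.
by apply: leq_trans kj; near: k; exact: nbhs_infty_ge.
Unshelve. all: by end_near. Qed.

Lemma bigTheta_bounds (R : realType) (f g : R -> R^o) : f =Theta_(0^'+) g ->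
  exists c1 c2 h0 : R, [/\ 0 < c1, 0 < c2, 0 < h0 &
    forall h, 0 < h < h0 -> c1 * `|g h| <= `|f h| /\ `|f h| <= c2 * `|g h|].
Proof.
rewrite eqThetaE => /asboolP[[c1 c2] /= /andP[c10 c20]].
rewrite /at_right /within/= => /nbhs_ballP[e /= e0 He].
exists c1, c2, e; split=> // h /andP[h0 he].
by apply: (He h) => //=; rewrite /ball/= sub0r normrN gtr0_norm.
Qed.

(** * Expected prediction error for a fixed step size *)

Section PredictionError.
Context (R : realType) (d dy n : nat) (disp : measure_display) (T : measurableType disp)
  (P : probability T R) (y : nat -> {mfun T >-> borel R dy})
  (xhs : {mfun borel R dy >-> borel R d}) (x : nat -> {mfun T >-> borel R d})
  (x0 : 'rV[R]_d) (xs : nat -> 'rV[R]_d) (alpha : 'cV[R]_n) (a : nat -> R)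
  (gamma D1 D2 delta : R).
Hypothesis indep : mutually_independent P (fun k => y k).
Hypotheses (D20 : 0 <= D2) (g0 : 0 <= gamma) (n0 : (0 < n)%N).
Hypothesis bias : forall k, enorm (vexpectation P (fun w => xhs (y k w)) - xs k) <= D1.
Hypothesis second_moment : forall k,
  ('E_P[fun w => (enorm ((xhs (y k w) : 'rV[R]_d) - xs k) ^+ 2)%R] <= (D2 ^+ 2)%:E)%E.
Hypothesis aE : forall i : 'I_n, alpha i 0 = a i.
Hypothesis x0E : forall w, x 0%N w = x0.

Let xv k w : 'rV[R]_d := x k w.
Let xh k w : 'rV[R]_d := predict alpha (fun j => x j w) k.
Let xo k w : 'rV[R]_d := xhs (y k w).
Let err k w : R := enorm (xh k w - xs k).

Hypothesis correction : forall k, {ae P, forall w,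
  enorm (xv k w - xo k w) <= gamma * enorm (xh k w - xo k w)}.

Let xhE k w : (0 < k)%N -> xh k w = \sum_(i < n) a i *: xv (k - i.+1)%N w.
Proof.
by move=> k0; rewrite /xh /predict gtn_eqF//; apply: eq_bigr => i _; rewrite aE.
Qed.

Let mxv k c : measurable_fun setT (fun w => xv k w 0 c).
Proof. exact: (measurableT_comp (measurable_coord c) (measurable_funP (x k))). Qed.

Let mxo k c : measurable_fun setT (fun w => xo k w 0 c).
Proof.
exact: (measurableT_comp (measurable_coord c)
  (measurableT_comp (measurable_funP xhs) (measurable_funP (y k)))).
Qed.

Let mxh k c : measurable_fun setT (fun w => xh k w 0 c).
Proof.
case: k => [|k]; first exact: mxv.
under eq_fun do rewrite xhE// summxE.
apply: measurable_sum => i; under eq_fun do rewrite mxE.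
by apply: measurable_funM => //; exact: mxv.
Qed.

Let merr k : measurable_fun setT (err k).
Proof.
apply: measurable_enorm => c; under eq_fun do rewrite !mxE.
by apply: measurable_funB => //; exact: mxh.
Qed.

Let xi k w : R := enorm (xo k w - xs k).

Let xi0 k w : 0 <= xi k w.
Proof. exact: enorm_ge0. Qed.

Let err0 k w : 0 <= err k w.
Proof. exact: enorm_ge0. Qed.

#[local] Hint Resolve xi0 err0 : core.

Let mxi k : measurable_fun setT (xi k).
Proof. exact: measurable_sample_error. Qed.

Let Exi k : ('E_P[xi k] <= D2%:E)%E.
Proof. exact: (sample_error_expectation D20 second_moment). Qed.

Let fin_real (f : T -> R) : (forall w, 0 <= f w) -> ('E_P[f] < +oo)%E ->
  ('E_P[f] <= (fine 'E_P[f])%:E)%E.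
Proof. by move=> f0 fy; rewrite fineK// ge0_fin_numE//; exact: expectation_ge0. Qed.

(** Finite means propagate from the deterministic [x0] through the correction inequality. They
    ensure that the initial errors have finite expectations, so that the transient can decay to
    0. *)
Let Exv k : ('E_P[fun w => enorm (xv k w)] < +oo)%E.
Proof.
elim/ltn_ind: k => k IH; case: (posnP k) => [->|k0].
  rewrite (_ : (fun w => enorm (xv 0 w)) = cst (enorm x0)) ?expectation_cst ?ltry//.
  by apply/funext => w; rewrite /xv x0E.
pose M i := fine 'E_P[fun w => enorm (xv (k - (i : 'I_n).+1)%N w)].
pose g w := \sum_(i < n) (gamma * `|a i|) * enorm (xv (k - i.+1)%N w).
(* The sum over one index puts the scalar factor into the form of [expectation_lin_le]. *)
pose h w := \sum_(i < 1) (1 + gamma) * (xi k w + enorm (xs k)).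
have mg : measurable_fun setT g.
  apply: measurable_sum => i; apply: measurable_funM => //.
  by apply: measurable_enorm => c; exact: mxv.
have mh : measurable_fun setT h.
  apply: measurable_sum => i; apply: measurable_funM => //.
  by apply: measurable_funD => //; exact: mxi.
have g0' w : 0 <= g w by apply: sumr_ge0 => i _; rewrite !mulr_ge0.
have h0' w : 0 <= h w by apply: sumr_ge0 => i _; rewrite mulr_ge0 ?addr_ge0.
have Eg : ('E_P[g] <= (\sum_(i < n) (gamma * `|a i|) * M i)%:E)%E.
  apply: expectation_lin_le => [i|i|i w|i] //.
  - by rewrite mulr_ge0.
  - by apply: measurable_enorm => c; exact: mxv.
  - apply: fin_real => //; apply: IH.
    by clear -k0; lia.
have Eh : ('E_P[h] <= (\sum_(i < 1) (1 + gamma) * (D2 + enorm (xs k)))%:E)%E.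
  apply: (expectation_lin_le (f := fun i w => xi k w + enorm (xs k))) => [i|i|i w|i].
  - by rewrite addr_ge0.
  - by apply: measurable_funD => //; exact: mxi.
  - by rewrite addr_ge0.
  - apply: expectation_add_le => //; exact: expectation_cst_le.
apply: le_lt_trans (le_lt_trans (expectation_add_le mh mg h0' g0' Eh Eg) (ltry _)).
apply: expectation_le => //.
- by apply: measurable_enorm => c; exact: mxv.
- exact: measurable_funD.
- by move=> w; rewrite addr_ge0.
apply: filterS (correction k) => w cw.
rewrite /h big_ord_recl big_ord0 addr0.
have h1 : enorm (xv k w) <= enorm (xv k w - xo k w) + enorm (xo k w).
  by rewrite -[X in enorm X <= _](subrK (xo k w)) enormD.
have h2 : enorm (xo k w) <= xi k w + enorm (xs k).
  by rewrite -[X in enorm X <= _](subrK (xs k)) enormD.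
have h3 : gamma * enorm (xh k w - xo k w) <= gamma * enorm (xh k w) + gamma * enorm (xo k w).
  by rewrite -mulrDr ler_wpM2l// enormB.
have h4 : gamma * enorm (xh k w) <= g w.
  rewrite xhE//; apply: le_trans (ler_wpM2l g0 (enorm_lin_sum _ _)) _.
  by rewrite big_distrr/=; apply: ler_sum => i _; rewrite mulrA.
have h5 := ler_wpM2l g0 h2.
lra.
Qed.

Let Eerr k : ('E_P[err k] < +oo)%E.
Proof.
have mxn j : measurable_fun setT (fun w => enorm (xv j w)).
  by apply: measurable_enorm => c; exact: mxv.
case: (posnP k) => [->|k0].
  rewrite (_ : err 0 = cst (enorm (x0 - xs 0%N))) ?expectation_cst ?ltry//.
  by apply/funext => w; rewrite /err /xh /predict eqxx x0E.
pose g w := \sum_(i < n) `|a i| * enorm (xv (k - i.+1)%N w).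
have mg : measurable_fun setT g.
  by apply: measurable_sum => i; apply: measurable_funM.
have g0' w : 0 <= g w by apply: sumr_ge0 => i _; rewrite !mulr_ge0.
have Eg : ('E_P[g] <= (\sum_(i < n) `|a i| * fine 'E_P[fun w => enorm (xv (k - i.+1)%N w)])%:E)%E.
  apply: expectation_lin_le => [i|i|i w|i] //.
  by apply: fin_real => //; exact: Exv.
apply: le_lt_trans (le_lt_trans (expectation_add_le mg
   (measurable_cst (enorm (xs k))) g0' (fun=> enorm_ge0 _) Eg (expectation_cst_le P _)) (ltry _)).
apply: expectation_le => //.
- exact: measurable_funD.
- by move=> w; rewrite addr_ge0//=.
apply: aeW => w; rewrite /err (le_trans (enormB _ _))// lerD// xhE//.
exact: enorm_lin_sum.
Qed.

Hypothesis prediction : forall k, (n < k)%N ->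
  enorm (\sum_(i < n) a i *: xs (k - i.+1)%N - xs k) <= delta.

Variables (lam D : R) (Q : nat).
Hypotheses (l0 : 0 <= lam) (l1 : lam < 1) (DD0 : 0 <= D) (Q0 : (0 < Q)%N).
Hypothesis superposition : forall (e g r : nat -> 'rV[R]_d) (xi : nat -> R),
    (forall j, 0 <= xi j) ->
    (forall j, enorm (r j) <= gamma * (enorm (e j) + xi j)) ->
    (forall k, (n <= k)%N -> e k = g k + \sum_(i < n) a i *: r (k - i.+1)%N) ->
    forall k, enorm (e k) <= \sum_(m < k.+1) superposition_kernel lam D n (Q * n) k m *
      (if (m < n)%N then enorm (e m)
       else enorm (g m) + gamma * \sum_(i < n) `|a i| * xi (m - i.+1)%N).

Let A1 := \sum_(i < n) `|a i|.
Let A2 := Num.sqrt (\sum_(i < n) a i ^+ 2).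
Let G := A1 * D1 + A2 * D2 + delta + gamma * (A1 * D2).

(* The whole scheme is shifted by one step, since [prediction] needs [n < k]. *)
Let noise k w : 'rV[R]_d := \sum_(i < n) a i *: (xo (k.+1 - i.+1)%N w - xs (k.+1 - i.+1)%N).
Let source m w : R := if (m < n)%N then err m.+1 w
  else (enorm (noise m w) + delta) + gamma * \sum_(i < n) `|a i| * xi (m.+1 - i.+1)%N w.

Let error_le_sources : {ae P, forall w, forall k,
  err k.+1 w <= \sum_(m < k.+1) superposition_kernel lam D n (Q * n) k m * source m w}.
Proof.
(* The countably many correction events are intersected first: superposition along a path uses all
   of them at once. *)
have /ae_foralln C := correction.
apply: filterS C => w Cw k.
pose b k' := \sum_(i < n) a i *: xs (k'.+1 - i.+1)%N - xs k'.+1.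
apply: le_trans (superposition (e := fun j => xh j.+1 w - xs j.+1) (g := fun j => noise j w + b j)
  (r := fun j => xv j.+1 w - xo j.+1 w) (xi := fun j => xi j.+1 w) _ _ _ k) _.
- by move=> j; exact: enorm_ge0.
- move=> j; rewrite (le_trans (Cw _))// ler_wpM2l//.
  have -> : xh j.+1 w - xo j.+1 w = (xh j.+1 w - xs j.+1) - (xo j.+1 w - xs j.+1).
    by rewrite opprB addrA subrK.
  exact: enormB.
- move=> k' nk'.
  (* The prediction error splits into the averaged sampling noise, the extrapolation bias [b] and
     the weighted solver residuals. *)
  have E (u v t s : 'rV[R]_d) : u + (v - t) + s = u + v + s - t.
    by rewrite -!addrA [- t + s]addrC.
  rewrite xhE// /b E /noise; congr (_ - _).
  rewrite -!big_split/=; apply: eq_bigr => i _.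
  have -> : ((k' - i.+1).+1 = k'.+1 - i.+1)%N.
    by rewrite subSn// (leq_trans (ltn_ord i)).
  by rewrite -!scalerDr subrK addrC subrK.
apply: ler_sum => m _; rewrite ler_wpM2l ?superposition_kernel_ge0//.
rewrite /source; case: ltnP => // nm; rewrite lerD//.
  by rewrite (le_trans (enormD _ _))// lerD// prediction.
rewrite ler_wpM2l//; apply: ler_sum => i _.
by rewrite subSn// (leq_trans (ltn_ord i)).
Qed.

Let msource m : measurable_fun setT (source m).
Proof.
rewrite /source; case: (m < n)%N; first exact: merr.
apply: measurable_funD.
  apply: measurable_funD => //; apply: measurable_enorm => c.
  under eq_fun do rewrite summxE.
  apply: measurable_sum => i; under eq_fun do rewrite !mxE.
  by apply: measurable_funM => //; apply: measurable_funB => //; exact: mxo.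
apply: measurable_funM => //; apply: measurable_sum => i.
by apply: measurable_funM => //; exact: mxi.
Qed.

Let delta0 : 0 <= delta.
Proof. exact: le_trans (enorm_ge0 _) (prediction (ltnSn n)). Qed.

Let source_ge0 m w : 0 <= source m w.
Proof.
rewrite /source; case: ifP => _ //; rewrite !addr_ge0// mulr_ge0// sumr_ge0// => i _.
by rewrite mulr_ge0.
Qed.

Let Esource m : (n <= m)%N -> ('E_P[source m] <= G%:E)%E.
Proof.
move=> nm; rewrite /source ltnNge nm /=.
have mn : measurable_fun setT (fun w => enorm (noise m w)).
  apply: measurable_enorm => c; under eq_fun do rewrite summxE.
  apply: measurable_sum => i; under eq_fun do rewrite !mxE.
  by apply: measurable_funM => //; apply: measurable_funB => //; exact: mxo.
apply: expectation_add_le.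
- exact: measurable_funD.
- apply: measurable_funM => //; apply: measurable_sum => i.
  by apply: measurable_funM => //; exact: mxi.
- by move=> w; rewrite addr_ge0.
- by move=> w; rewrite mulr_ge0// sumr_ge0// => i _; rewrite mulr_ge0.
- apply: expectation_add_le => //; last exact: expectation_cst_le.
  exact: (noise_average indep D20 bias second_moment a (leqW nm)).
under [X in ('E__[X])%E]eq_fun do rewrite big_distrr/=.
under [X in ('E__[X])%E]eq_fun => w do under eq_bigr => i _ do rewrite mulrA.
have -> : gamma * (A1 * D2) = \sum_(i < n) (gamma * `|a i|) * D2.
  by rewrite /A1 big_distrl big_distrr/=; apply: eq_bigr => i _; rewrite mulrA.
apply: (expectation_lin_le (f := fun i w => xi (m.+1 - i.+1)%N w)) => [i|i|i w|i].
- by rewrite mulr_ge0.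
- exact: mxi.
- exact: enorm_ge0.
- exact: Exi.
Qed.

(** This transient may depend on h, [x0] and the whole problem; its factor tends to 0, so it drops
    out of the upper limit. *)
Let S := \sum_(m < n) fine 'E_P[err m.+1].

Let error_expectation_le k : (n <= k)%N ->
  ('E_P[err k.+1] <= (lam ^+ (k %/ (Q * n)) * S + (1 + D + D * Q%:R / (1 - lam)) * G)%:E)%E.
Proof.
move=> nk; pose kap := superposition_kernel lam D n (Q * n) k.
have kap0 m : 0 <= kap m by exact: superposition_kernel_ge0.
have fin1 m : ('E_P[err m.+1] <= (fine 'E_P[err m.+1])%:E)%E.
  by apply: fin_real => [w|]; [exact: enorm_ge0|exact: Eerr].
apply: (@le_trans _ _ ('E_P[fun w => (\sum_(m < k.+1) kap m * source m w)%R])%E).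
  apply: expectation_le => //.
  - by apply: measurable_sum => m; apply: measurable_funM.
  - by move=> w; rewrite sumr_ge0// => m _; rewrite mulr_ge0.
  - by apply: filterS error_le_sources => w; apply.
apply: le_trans (expectation_lin_le (M := fun m : 'I_k.+1 =>
  if (m < n)%N then fine 'E_P[err m.+1] else G) _ _ _ _) _ => //.
  move=> m; case: ltnP => mn; last exact: Esource.
  by rewrite /source mn.
rewrite lee_fin (bigID (fun m : 'I_k.+1 => (m < n)%N))/= lerD//.
  apply: (@le_trans _ _ (\sum_(m < k.+1 | (m < n)%N) lam ^+ (k %/ (Q * n)) * fine 'E_P[err m.+1])).
    apply: ler_sum => m mn; rewrite mn /kap /superposition_kernel mn gtn_eqF ?add0r//.
    exact: leq_trans nk.
  rewrite -big_distrr/= ler_wpM2l ?exprn_ge0// /S.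
  by rewrite (big_ord_widen k.+1 (fun m => fine 'E_P[err m.+1]))// leqW.
have G0 : 0 <= G.
  rewrite -lee_fin; apply: le_trans (Esource (leqnn n)); apply: expectation_ge0.
  exact: source_ge0.
apply: (@le_trans _ _ (\sum_(m < k.+1 | (n <= m)%N) kap m * G)).
  rewrite le_eqVlt; apply/orP; left; apply/eqP.
  by apply: eq_big => m; [rewrite -leqNgt|move=> /negPf ->].
by rewrite -big_distrl/= ler_wpM2r// superposition_kernel_sum.
Qed.

Lemma prediction_error_limsup :
  (limn_esup (fun k => 'E_P[fun w => enorm (xh k w - xs k)])
   <= ((1 + D + D * Q%:R / (1 - lam)) * G)%:E)%E.
Proof.
apply: limn_esup_le_eventually => eta eta0.
have S0 : 0 <= S.
  by apply: sumr_ge0 => m _; rewrite fine_ge0// expectation_ge0// => w; exact: enorm_ge0.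
have [l lS] : exists l, forall l', (l <= l')%N -> lam ^+ l' * S <= eta.
  have : (fun l : nat => lam ^+ l) @ \oo --> (0 : R).
    by apply: cvg_expr; rewrite ger0_norm.
  have e0 : 0 < eta / (S + 1) by rewrite divr_gt0// ltr_wpDl.
  move=> /cvgrPdist_lt /(_ _ e0) [l _ Hl]; exists l => l' ll'.
  have := Hl l' ll'; rewrite /= sub0r normrN ger0_norm ?exprn_ge0//.
  rewrite ltr_pdivlMr ?ltr_wpDl// mulrDr mulr1 => /ltW h.
  by apply: le_trans h; rewrite lerDl exprn_ge0.
exists (l * (Q * n) + n).+1 => k; case: k => // k; rewrite ltnS => lk.
have nk : (n <= k)%N by apply: leq_trans lk; rewrite leq_addl.
apply: le_trans (error_expectation_le nk) _; rewrite lee_fin addrC lerD2l.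
apply: lS; rewrite leq_divRL ?muln_gt0 ?Q0//.
by apply: leq_trans lk; rewrite leq_addr.
Qed.

End PredictionError.

(** * Choice of the constants and conclusion *)

Lemma regular_weights_weaken (R : realType) (C C' : R) n a : 0 <= C -> C <= C' ->
  regular_weights C n a -> regular_weights C' n a.
Proof.
move=> C0 CC [s n1 b l lo]; split=> //.
- exact: le_trans CC.
- by move=> i ni; rewrite (le_trans (b i ni))// ler_wpM2r// invr_ge0.
- by move=> i ni; rewrite (le_trans (l i ni))// ler_wpM2r// invr_ge0 exprn_ge0.
- move=> i ni h; apply: lo => //; apply: le_trans h.
  by rewrite ler_wpM2r// ler_wpM2l.
Qed.

Lemma regular_weights_sqr (R : realType) (C : R) n a : (0 < n)%N -> 0 <= C ->
  regular_weights C n a -> \sum_(i < n) a i ^+ 2 <= C ^+ 2 / n%:R.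
Proof.
move=> n0 C0 rw.
apply: (@le_trans _ _ (\sum_(i < n) C / n%:R * `|a i|)).
  apply: ler_sum => i _; rewrite -real_normK ?num_real// expr2 ler_wpM2r//.
  exact: (rw_bound rw).
have -> : C ^+ 2 / n%:R = C / n%:R * C by rewrite expr2 mulrAC.
by rewrite -big_distrr/= ler_wpM2l ?divr_ge0// (rw_norm1 rw).
Qed.

(** With u = h^(1/(2q+1)) all rates become integer powers: n is of order u^(-2q) and n h of order u,
    so n^(-1/2) and (n h)^q are both of order u^q. *)
Lemma step_size_root (R : realType) (q : nat) (h : R) : 0 < h ->
  let u := h `^ ((2 * q + 1)%:R^-1) in
  [/\ 0 < u, h = u ^+ (2 * q + 1), h `^ (q%:R / (2 * q + 1)%:R) = u ^+ q &
      h `^ (- ((2 * q)%:R / (2 * q + 1)%:R)) = (u ^+ (2 * q))^-1].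
Proof.
move=> h0 u; have u0 : 0 < u by exact: powR_gt0.
have E m : h `^ (m%:R / (2 * q + 1)%:R) = u ^+ m.
  by rewrite mulrC powRrM powR_mulrn// ltW.
split=> //; last by rewrite powRN E.
by rewrite -E divff ?powRr1 ?(ltW h0)// addn1 pnatr_eq0.
Qed.

Theorem mainTheorem2 (R : realType) (d dy p q : nat) (gamma B : R)
    (n : R -> nat) :
  (1 <= q <= p)%N ->
  0 <= gamma ->
  ((fun h : R => ((n h)%:R : R^o)) =Theta_(0^'+)
     (fun h : R => (h `^ (- ((2 * q)%:R / (2 * q + 1)%:R)) : R^o))) ->
  exists C h0 : R, [/\ 0 < C, 0 < h0 &
  forall (h : R)
    (P : R -> probability (borel R dy) R)
    (l : 'rV[R]_d -> 'rV[R]_dy -> R)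
    (psi : 'rV[R]_d -> \bar R)
    (xs : R -> 'rV[R]_d)
    (sigma1 mu L20 Delta1 Delta2 : R)
    (dO : measure_display) (Omega : measurableType dO)
    (Pr : probability Omega R)
    (y : nat -> {mfun Omega >-> borel R dy})
    (xhs : {mfun borel R dy >-> borel R d})
    (x0 : 'rV[R]_d)
    (x : nat -> {mfun Omega >-> borel R d}),
  let alpha := pralpha R p (n h) in
  let t := fun k : nat => k%:R * h in
  let xhat := fun (k : nat) (w : Omega) => predict alpha (fun j => x j w) k in
  let e := fun k : nat => ('E_Pr[fun w => enorm (xhat k w - xs (t k))])%E in
  0 < h < h0 ->
  (p <= n h)%N ->
  (forall (z : 'rV[R]_dy) (u : 'rV[R]_d),
     differentiable ((fun v => l v z) : 'rV[R]_d -> R^o) u) ->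
  (forall s, 0 <= s -> is_argmin (objective P l psi s) (xs s)) ->
  (forall z, is_argmin (sample_objective l psi z) (xhs z)) ->
  (forall k (A : set (borel R dy)), measurable A ->
     distribution Pr (y k) A = P (t k) A) ->
  mutually_independent Pr (fun k => y k) ->
  (forall w, x 0%N w = x0) ->
  hl_n_derivable q xs ->
  (forall s, 0 <= s -> enorm (hl_deriven q xs s) <= B) ->
  0 <= sigma1 -> 0 < mu -> 0 < L20 ->
  (forall (u : 'rV[R]_d) (s : R), 0 <= s ->
     (P s).-integrable setT (fun z => (l u z)%:E) /\
     (P s).-integrable setT (fun z => (enorm (grad (fun v => l v z) u))%:E)) ->
  (forall k : nat,
     ('E_(P (t k))[fun z =>
        (enorm (grad (fun v => l v z) (xs (t k))
               - vexpectation (P (t k))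
                   (fun z' => grad (fun v => l v z') (xs (t k)))) ^+ 2)%R]
      <= (sigma1 ^+ 2)%:E)%E) ->
  (forall (u v : 'rV[R]_d) (z : 'rV[R]_dy),
     l v z + dotv (grad (fun a => l a z) v) (u - v)
       + mu / 2 * enorm (u - v) ^+ 2 <= l u z) ->
  (forall (u v : 'rV[R]_d) (z : 'rV[R]_dy),
     l u z <= l v z + dotv (grad (fun a => l a z) v) (u - v)
       + L20 / 2 * enorm (u - v) ^+ 2) ->
  proper_fun psi -> closed_fun psi -> convex_fun psi ->
  gamma < (l1norm alpha)^-1 ->
  (forall k : nat, {ae Pr, forall w,
     enorm (x k w - xhs (y k w)) <= gamma * enorm (xhat k w - xhs (y k w))}) ->
  0 <= Delta1 -> 0 <= Delta2 ->
  (forall k : nat,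
     enorm (vexpectation Pr (fun w => xhs (y k w)) - xs (t k)) <= Delta1) ->
  (forall k : nat,
     ('E_Pr[fun w => (enorm (xhs (y k w) - xs (t k)) ^+ 2)%R]
      <= (Delta2 ^+ 2)%:E)%E) ->
  (limn_esup e
   <= (C * (Delta1 + gamma * Delta2
            + (Delta2 + 1) * h `^ (q%:R / (2 * q + 1)%:R)))%:E)%E].
Proof.
move=> /andP[q0 qp] g0 /bigTheta_bounds[c1 [c2 [hT [c10 c20 hT0 HT]]]].
have p0 : (0 < p)%N by exact: leq_trans qp.
have sum1 m : (p <= m)%N -> 1 <= l1norm (pralpha R p m).
  move=> pm; rewrite -(@pralpha_sum R p m) ?p0// /l1norm.
  by apply: ler_sum => i _; exact: ler_norm.
(* The weights sum to 1, so their l1 norm is at least 1 and gamma >= 1 contradicts the hypothesis on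
   gamma. *)
have [g1|g1] := leP 1 gamma.
  exists 1, 1; split=> // h P l psi xs s1 mu L D1 D2 dO Om Pr y xhs x0 x /=.
  move=> _ pn _ _ _ _ _ _ _ _ _ _ _ _ _ _ _ _ _ _ gl.
  exfalso; move: gl; apply/negP; rewrite -leNgt.
  rewrite (le_trans _ g1)// invf_le1 ?sum1// (lt_le_trans ltr01)// sum1//.
have [C0 C01 HC0] := pralpha_regular R p0.
(* The constant is rounded up to an integer because the window lengths are quotients of natural
   numbers by multiples of it. *)
have [c cC0] := natr_ge_exists C0.
have cR : 1 <= c%:R :> R by exact: le_trans cC0.
have c0 : (0 < c)%N by rewrite -(ltr_nat R) (lt_le_trans ltr01).
have [lam [D [l0 l1 DD0 [Q [N0 [Q0 HS]]]]]] := superposition_bound d g0 g1 c0.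
pose C2 := 1 + D + D * Q%:R / (1 - lam).
(* [K1] will bound the l1 norm of the weights, while [K2] and [K3] times u^q bound their l2 norm and
   the extrapolation error. [B] enters through its absolute value since its sign is known only once
   a trajectory is given. *)
pose K1 : R := c%:R.
pose K2 : R := c%:R / Num.sqrt c1.
pose K3 : R := d%:R * (c%:R * (`|B| * c2 ^+ q)).
(* For u below both bounds, n >= c1 u^(-2q) >= c1 / u > N0, so the superposition bound applies. *)
pose u2 := Num.min 1 (c1 / N0.+1%:R).
have u20 : 0 < u2 by rewrite lt_min ltr01 divr_gt0.
have C21 : 1 <= C2.
  by rewrite /C2 -addrA lerDl addr_ge0// divr_ge0 ?mulr_ge0// subr_ge0 ltW.
have K20 : 0 <= K2 by rewrite divr_ge0 ?sqrtr_ge0.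
have K30 : 0 <= K3 by rewrite !mulr_ge0// exprn_ge0// ltW.
exists (C2 * (K1 + K2 + K3)), (Num.min hT (u2 ^+ (2 * q + 1))); split.
- by rewrite mulr_gt0 ?(lt_le_trans ltr01 C21)// !ltr_wpDr// (lt_le_trans ltr01).
- by rewrite lt_min hT0 exprn_gt0.
move=> h P l psi xs s1 mu L D1 D2 dO Om Pr y xhs x0 x alpha t xhat e.
move=> /andP[h0]; rewrite lt_min => /andP[hhT hu2] pn _ _ _ _ indep x0E dxs Bxs _ _ _ _ _ _ _ _ _ _.
move=> gl corr D10 D20 bias second.
have [u0 hE hq ha] := step_size_root q h0; set u := h `^ _ in u0 hE hq ha.
rewrite hq.
have uu2 : u < u2.
  rewrite ltNge; apply/negP => u2u; move: hu2; rewrite hE; apply/negP; rewrite -leNgt.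
  by rewrite lerXn2r// nnegrE ltW.
have [uu1 uc1] : u < 1 /\ u < c1 / N0.+1%:R by move: uu2; rewrite lt_min => /andP.
pose N := n h; rewrite -/N in pn.
have n0 : (0 < N)%N by exact: leq_trans pn.
have nR : 0 < N%:R :> R by rewrite ltr0n.
have [Nlo Nhi] : c1 * (u ^+ (2 * q))^-1 <= N%:R /\ N%:R <= c2 * (u ^+ (2 * q))^-1.
  have := HT h; rewrite h0 hhT => /(_ isT); rewrite ha normr_nat.
  by rewrite ger0_norm// invr_ge0 exprn_ge0// ltW.
have uq0 : 0 < u ^+ (2 * q) by rewrite exprn_gt0.
have nN : (N0 <= N)%N.
  rewrite -(ler_nat R); apply: le_trans Nlo; apply: (@le_trans _ _ N0.+1%:R).
    by rewrite ler_nat.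
  rewrite ler_pdivlMr// mulrC -ler_pdivlMr//; apply: le_trans (ltW uc1).
  by rewrite -[leRHS]expr1 ler_wiXn2l ?(ltW u0) ?(ltW uu1)// muln_gt0.
pose a := prweight R p N.
have aE (i : 'I_N) : alpha i 0 = a i by rewrite /a prweightE.
have rw : regular_weights c%:R N a.
  by apply: regular_weights_weaken cC0 (HC0 _ pn); rewrite (le_trans ler01).
have A1E : l1norm alpha = \sum_(i < N) `|a i| by apply: eq_bigr => i _; rewrite aE.
have ga : gamma * \sum_(i < N) `|a i| <= 1.
  rewrite -A1E -ler_pdivlMr ?div1r ?(ltW gl)//.
  by rewrite (lt_le_trans ltr01)// sum1.
pose delta := d%:R * ((\sum_(i < N) `|a i|) * (B * (N%:R * h) ^+ q)).
have np : (0 < p <= N)%N by rewrite p0.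
have qp' : (0 < q <= p)%N by rewrite q0.
have pred k : (N < k)%N ->
    enorm (\sum_(i < N) a i *: xs (t (k - i.+1)%N) - xs (t k)) <= delta.
  by move=> Nk; exact: prediction_bias.
have sup := HS N a _ _ _ _ nN n0 rw ga.
have := prediction_error_limsup indep D20 g0 n0 bias second aE x0E corr pred l0 l1 DD0 Q0 sup.
move=> H; apply: le_trans H _; rewrite lee_fin -/C2 -mulrA ler_wpM2l ?(le_trans ler01)//.
set A1 := \sum_(i < N) `|a i|; set A2 := Num.sqrt _; set U := u ^+ q.
have A1c : A1 <= K1 := rw_norm1 rw.
have A10 : 0 <= A1 by exact: sumr_ge0.
have U0 : 0 <= U by rewrite exprn_ge0// ltW.
have A2c : A2 <= K2 * U.
  have KU : 0 <= K2 * U by rewrite mulr_ge0.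
  rewrite -[leRHS]ger0_norm// -sqrtr_sqr ler_wsqrtr//.
  rewrite (le_trans (regular_weights_sqr n0 (ler0n _ c) rw))//.
  rewrite exprMn /K2 expr_div_n sqr_sqrtr ?(ltW c10)// -[leRHS]mulrA.
  rewrite ler_wpM2l ?exprn_ge0//.
  rewrite /U -exprM mulnC -[leRHS]invrK lef_pV2 ?posrE ?invr_gt0 ?mulr_gt0 ?invr_gt0//.
  by rewrite invfM invrK.
have deltac : delta <= K3 * U.
  have Nh : N%:R * h <= c2 * u.
    rewrite {1}hE addn1 exprSr mulrA ler_wpM2r ?(ltW u0)//.
    by rewrite -ler_pdivlMr.
  have NhU : (N%:R * h) ^+ q <= c2 ^+ q * U.
    by rewrite /U -exprMn lerXn2r// nnegrE ?mulr_ge0 ?(ltW h0) ?(ltW c20) ?(ltW u0).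
  have B0 : 0 <= B := le_trans (enorm_ge0 _) (Bxs 0 (lexx 0)).
  have Nh0 : 0 <= (N%:R * h) ^+ q by rewrite exprn_ge0// mulr_ge0 ?(ltW h0).
  rewrite /delta /K3 -!mulrA ler_wpM2l// ler_pM ?mulr_ge0// ger0_norm// ler_wpM2l//.
have K10 : 0 <= K1 by rewrite ler0n.
have h1 : A1 * D1 <= K1 * D1 by rewrite ler_wpM2r.
have h2 : A2 * D2 <= K2 * U * D2 by rewrite ler_wpM2r.
have h3 : gamma * (A1 * D2) <= K1 * (gamma * D2).
  by rewrite mulrCA ler_wpM2r// mulr_ge0.
(* Expanding the right-hand side yields every product of some K with an error term; those without a
   counterpart on the left are nonnegative, and [lra] treats them as atoms. *)
have e1 := mulr_ge0 K20 D10; have e2 := mulr_ge0 K30 D10.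
have e3 := mulr_ge0 K20 (mulr_ge0 g0 D20); have e4 := mulr_ge0 K30 (mulr_ge0 g0 D20).
have e5 := mulr_ge0 K10 (mulr_ge0 D20 U0); have e6 := mulr_ge0 K30 (mulr_ge0 D20 U0).
have e7 := mulr_ge0 K10 U0; have e8 := mulr_ge0 K20 U0.
lra.
Qed.
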